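(* Let $0<\alpha_2<\alpha_1<1$, $\lambda>0$, $C_1>0$, $C_2\ge 0$ with $C_1+C_2=1$, and let $p_n^{\alpha_1,\alpha_2}(t)=\mathrm{Pr}\{N^{\alpha_1,\alpha_2}(t)=n\}$ be the state probabilities of the mixed fractional Poisson process $\{N^{\alpha_1,\alpha_2}(t)\}_{t\ge0}$. Then for every integer $n\ge 0$ and $t>0$, $$p_n^{\alpha_1,\alpha_2}(t)=\frac{\lambda^n}{C_1^{n+1}}\left(C_1 f^{*(n+1)}(t)+C_2\, g^{*(n+1)}(t)\right),$$ where (for the given $n$) $$f(t)=t^{\frac{n(\alpha_1-1)}{n+1}}\sum_{k=0}^{\infty}\left(-\frac{C_2t^{\alpha_1-\alpha_2}}{C_1}\right)^{k}E^{k+1}_{\alpha_1,(\alpha_1-\alpha_2)k+\frac{n\alpha_1+1}{n+1}}\left(-\frac{\lambda t^{\alpha_1}}{C_1}\right),$$ $$g(t)=t^{\frac{n(\alpha_1-1)+\alpha_1-\alpha_2}{n+1}}\sum_{k=0}^{\infty}\left(-\frac{C_2t^{\alpha_1-\alpha_2}}{C_1}\right)^{k}E^{k+1}_{\alpha_1,(\alpha_1-\alpha_2)k+\frac{n\alpha_1+\alpha_1-\alpha_2+1}{n+1}}\left(-\frac{\lambda t^{\alpha_1}}{C_1}\right),$$ and $f^{*(n+1)}$, $g^{*(n+1)}$ denote the $(n+1)$-fold convolutions of $f$ and $g$ respectively.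
   Context: The mixed stable subordinator $\{D_{\alpha_1,\alpha_2}(t)\}_{t\ge0}$ is the subordinator (non-decreasing L\'evy process) with $\mathbb{E}(e^{-sD_{\alpha_1,\alpha_2}(t)})=e^{-t(C_1s^{\alpha_1}+C_2s^{\alpha_2})}$, $s\ge0$. Its inverse is $Y_{\alpha_1,\alpha_2}(t)=\inf\{s\ge0:D_{\alpha_1,\alpha_2}(s)>t\}$, $t\ge0$. The mixed fractional Poisson process (MFPP) is $N^{\alpha_1,\alpha_2}(t)=N(Y_{\alpha_1,\alpha_2}(t))$, $t\ge0$, where $\{N(t)\}_{t\ge0}$ is a homogeneous Poisson process with intensity $\lambda$ independent of $\{Y_{\alpha_1,\alpha_2}(t)\}_{t\ge0}$. The three-parameter Mittag-Leffler function is $$E^{\gamma}_{\alpha,\beta}(x)=\sum_{k=0}^{\infty}\frac{\gamma(\gamma+1)\cdots(\gamma+k-1)\,x^k}{k!\,\Gamma(k\alpha+\beta)},\quad \alpha,\beta,\gamma>0.$$ Convolution is on $(0,\infty)$: $(h_1*h_2)(t)=\int_0^t h_1(t-s)h_2(s)\,\mathrm{d}s$, and $h^{*1}=h$. *)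

(* Defs.v *)
From HB Require Import structures.
From mathcomp Require Import all_boot all_order all_algebra.
From mathcomp Require Import all_classical all_reals all_analysis.

Set Implicit Arguments.
Unset Strict Implicit.
Unset Printing Implicit Defensive.
Import Order.TTheory GRing.Theory Num.Theory.
Import numFieldNormedType.Exports.

Local Open Scope classical_set_scope.
Local Open Scope ring_scope.

(* Stochastic processes are functions of a time in R and of a sample point;
   only their values at times t >= 0 are ever constrained. *)

Section independence.
Context {d : measure_display} {T : measurableType d} {R : realType}.
Variable P : probability T R.

Definition mutually_independent {d' : measure_display} {U : measurableType d'}
    {I : finType} (X : I -> T -> U) : Prop :=
  forall (J : {set I}) (B : I -> set U), (forall i, measurable (B i)) ->
    P (\bigcap_(i in [set i | i \in J]) X i @^-1` B i) =
    (\prod_(i in J) P (X i @^-1` B i))%E.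

Definition process_sigma_algebra {d' : measure_display}
    {U : measurableType d'} (X : R -> T -> U) : set_system T :=
  <<s \bigcup_(t in [set t : R | 0 <= t])
        preimage_set_system setT (X t) measurable >>.

Definition independent_processes {d1 d2 : measure_display}
    {U1 : measurableType d1} {U2 : measurableType d2}
    (X : R -> T -> U1) (Y : R -> T -> U2) : Prop :=
  forall A B : set T, process_sigma_algebra X A -> process_sigma_algebra Y B ->
    P (A `&` B) = (P A * P B)%E.

End independence.

Section processes.
Context {d : measure_display} {T : measurableType d} {R : realType}.
Variable P : probability T R.

(* Stochastic continuity is not listed: it follows from right-continuity of the
   paths and stationarity of the increments. *)
Record levy_process (X : R -> T -> R) : Prop := LevyProcess {
  levy_measurable : forall t : R, 0 <= t -> measurable_fun setT (X t);
  levy_start : {ae P, forall w, X 0 w = 0};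
  levy_independent_increments : forall (tau : nat -> R) (m : nat),
    0 <= tau 0%N -> {homo tau : i j / (i <= j)%N >-> i <= j} ->
    mutually_independent P
      (fun (i : 'I_m) (w : T) => X (tau i.+1) w - X (tau i) w);
  levy_stationary_increments : forall s t : R, 0 <= s -> s <= t ->
    forall B : set R, measurable B ->
    P ((fun w => X t w - X s w) @^-1` B) = P (X (t - s) @^-1` B);
  levy_right_continuous : forall (w : T) (t : R), 0 <= t ->
    X s w @[s --> t^'+] --> X t w;
  levy_left_limits : forall (w : T) (t : R), 0 < t -> cvg (X s w @[s --> t^'-])
}.

Definition subordinator (X : R -> T -> R) : Prop :=
  levy_process X /\
  forall (w : T) (s t : R), 0 <= s -> s <= t -> X s w <= X t w.

Definition mixed_stable_subordinator (alpha1 alpha2 C1 C2 : R)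
    (D : R -> T -> R) : Prop :=
  subordinator D /\
  forall s t : R, 0 <= s -> 0 <= t ->
    'E_P[fun w => expR (- (s * D t w))]%E =
    (expR (- (t * (C1 * s `^ alpha1 + C2 * s `^ alpha2))))%:E.

(* [inf] of the empty set is 0; this only concerns sample points whose path
   is bounded by t. *)
Definition inverse_subordinator (D : R -> T -> R) (t : R) (w : T) : R :=
  inf [set s : R | 0 <= s /\ t < D s w].

(* N is cast to R so that its increments are true, not truncated,
   differences. *)
Definition poisson_process (lambda : R) (N : R -> T -> nat) : Prop :=
  levy_process (fun t w => (N t w)%:R) /\
  forall (s t : R) (k : nat), 0 <= s -> s < t ->
    P [set w | (N t w)%:R - (N s w)%:R = k%:R :> R] =
    (poisson_pmf (lambda * (t - s)) k)%:E.

Definition mixed_fractional_poisson (N : R -> T -> nat) (D : R -> T -> R)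
    (t : R) (w : T) : nat :=
  N (inverse_subordinator D t w) w.

Definition state_probability (M : R -> T -> nat) (n : nat) (t : R) : \bar R :=
  P [set w | M t w = n].

End processes.

Section special_functions.
Context {R : realType}.

Definition Gamma_function (a : R) : R :=
  \int[lebesgue_measure]_(x in `]0, +oo[) (x `^ (a - 1) * expR (- x)).

Definition mittag_leffler (alpha beta gamma x : R) : R :=
  limn (series (fun k : nat =>
    (\prod_(j < k) (gamma + j%:R)) * x ^+ k /
    (k`!%:R * Gamma_function (k%:R * alpha + beta)))).

Definition convolution (h1 h2 : R -> R) (t : R) : R :=
  \int[lebesgue_measure]_(s in `]0, t[) (h1 (t - s) * h2 s).

(* Meaningful for m >= 1 only. *)
Definition convolution_power (h : R -> R) (m : nat) : R -> R :=
  iter m.-1 (convolution h) h.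

Definition mfpp_f (alpha1 alpha2 lambda C1 C2 : R) (n : nat) (t : R) : R :=
  t `^ (n%:R * (alpha1 - 1) / n.+1%:R) *
  limn (series (fun k : nat =>
    (- (C2 * t `^ (alpha1 - alpha2) / C1)) ^+ k *
    mittag_leffler alpha1
      ((alpha1 - alpha2) * k%:R + (n%:R * alpha1 + 1) / n.+1%:R)
      k.+1%:R
      (- (lambda * t `^ alpha1 / C1)))).

Definition mfpp_g (alpha1 alpha2 lambda C1 C2 : R) (n : nat) (t : R) : R :=
  t `^ ((n%:R * (alpha1 - 1) + alpha1 - alpha2) / n.+1%:R) *
  limn (series (fun k : nat =>
    (- (C2 * t `^ (alpha1 - alpha2) / C1)) ^+ k *
    mittag_leffler alpha1
      ((alpha1 - alpha2) * k%:R +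
       (n%:R * alpha1 + alpha1 - alpha2 + 1) / n.+1%:R)
      k.+1%:R
      (- (lambda * t `^ alpha1 / C1)))).

End special_functions.

(* Main.v *)
Require Import Defs.
From HB Require Import structures.
From mathcomp Require Import all_boot all_order all_algebra.
From mathcomp Require Import all_classical all_reals all_analysis.
From mathcomp Require Import measurable_realfun ring lra.

(* With phi(s) = C1 s^alpha1 + C2 s^alpha2, both sides have Laplace transform
   lambda^n (phi(s) / s) / (lambda + phi(s))^(n+1) for large s, and both are
   right-continuous on (0, oo); such functions are determined by their transform.

   Left side: conditioning on the independent inverse subordinator Y gives
   Pr{N(Y(t)) = n} = E[(lambda Y(t))^n e^(-lambda Y(t)) / n!].  Since Y(t) > y
   iff D(y) <= t up to null events, Y evaluated at an independent exponential
   time of rate s is exponential of rate phi(s); averaging the weight against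
   this law gives the transform.

   Right side: f and g are double series of powers t^(b-1) / Gamma(b), whose
   transforms s^(-b) sum by the negative binomial and geometric series to
   C1 s^(alpha1 - b) / (lambda + phi(s)), where b is the first exponent of the
   series.  Convolution powers become powers, and the exponents of f and g are
   chosen so that (n+1)(alpha1 - b) is alpha1 - 1, respectively alpha2 - 1. *)

Set Implicit Arguments.
Unset Strict Implicit.
Unset Printing Implicit Defensive.
Import Order.TTheory GRing.Theory Num.Theory.
Import numFieldNormedType.Exports.
Local Open Scope classical_set_scope.
Local Open Scope ring_scope.

(** The right side rests on one majorant, M t^(b-1) e^(ct): b > 0 is the order of the singularity at
    0 and c the growth rate. Such bounds survive convolution, where the b add up and c is kept, and
    summation, provided one pair (b, c) serves all terms. The exponents B of the double series drift
    to infinity, so t^(B-1) / Gamma(B) has to be bounded with geometric decay in B for all t at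
    once. The price is a factor e^(2ct), and c is taken so large that the coefficients, with
    binomials bounded by powers of 2, are beaten with ratio 1/2. Hence the transforms are controlled
    for s > 2c only, and uniqueness has to start from equality on a half-line. On the left, the law
    of Y(t) at a fixed t is never computed. Since D(0) = 0 and unboundedness of the paths hold
    almost surely only, and inf of the empty set is 0, the exceptional paths are followed
    explicitly. To condition on Y(t), it is replaced by grid values above it, where independence
    gives a countable sum. *)

Local Notation mu := lebesgue_measure.

(** * Affine changes of variable and the Gamma integral *)

Section affine_change_of_variable.
Context {R : realType}.
Variables (a b : R).
Hypothesis a0 : a != 0.
Local Notation phi := ((fun x : R => a * x + b) : R -> measurableTypeR R).

Let mphi : measurable_fun setT phi.
Proof. by apply: measurable_funD => //; apply: measurable_funM. Qed.

Let nu : {measure set (measurableTypeR R) -> \bar R}.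
Proof.
unshelve refine (pushforward mu phi : {measure set (measurableTypeR R) -> \bar R}).
exact: mphi.
Defined.

(** The scaled image measure has the right value on the intervals ]u, v], which determine Lebesgue
    measure. For negative [a] the preimage is closed on the other side, hence the two cases. *)
Lemma lebesgue_measure_affine (A : set R) : measurable A ->
  mu A = (`|a|%:E * pushforward mu phi A)%E.
Proof.
move=> mA.
have -> : (`|a|%:E * pushforward mu phi A = mscale (NngNum (normr_ge0 a)) nu A)%E by [].
apply: lebesgue_measure_unique => //= _ [[u v]] _ <-.
rewrite /mscale/= /nu/= /pushforward.
have [a_lt0|a_gt0|aE0] := ltgtP a 0; last by move: a0; rewrite aE0 eqxx.
- have -> : phi @^-1` `]u, v] = `[(v - b) / a, (u - b) / a[%classic.
    by apply/seteqP; split => x /=; rewrite !in_itv/= ler_ndivrMr// ltr_ndivlMr//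
      ltrBlDr lerBrDr mulrC andbC.
  rewrite !lebesgue_measure_itv/= !lte_fin ltr_nM2r ?invr_lt0// ltrD2r ltr0_norm//.
  by case: ifPn => _; rewrite ?mule0// -EFinM; congr EFin; field.
- have -> : phi @^-1` `]u, v] = `](u - b) / a, (v - b) / a]%classic.
    by apply/seteqP; split => x /=; rewrite !in_itv/= ltr_pdivrMr// ler_pdivlMr//
      ltrBlDr lerBrDr mulrC.
  rewrite !lebesgue_measure_itv/= !lte_fin ltr_pM2r ?invr_gt0// ltrD2r gtr0_norm//.
  by case: ifPn => _; rewrite ?mule0// -EFinM; congr EFin; field.
Qed.

(** Image measures settle nonnegative functions; the general case subtracts the positive and
    negative parts. These integrals may be infinite, and the final case analysis checks that a
    finite positive factor still distributes over the difference. *)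
Lemma integral_affine (D : set R) (f : R -> \bar R) : measurable D ->
  measurable_fun D f ->
  (\int[mu]_(x in D) f x = `|a|%:E * \int[mu]_(x in phi @^-1` D) f (a * x + b)%R)%E.
Proof.
move=> mD.
have key g : measurable_fun D g -> (forall x, 0 <= g x)%E ->
    (\int[mu]_(x in D) g x = `|a|%:E * \int[mu]_(x in phi @^-1` D) g (a * x + b)%R)%E.
  move=> mg g0.
  transitivity (\int[mscale (NngNum (normr_ge0 a)) nu]_(y in D) g y)%E.
    by apply: eq_measure_integral => A mA _ /=; exact: lebesgue_measure_affine.
  rewrite ge0_integral_mscale//=; congr (_ * _)%E.
  by rewrite ge0_integral_pushforward.
move=> mf; rewrite integralE [in RHS]integralE.
rewrite (key f^\+%E)//; last exact: measurable_funepos.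
rewrite (key f^\-%E)//; last exact: measurable_funeneg.
have ge0 (g : R -> \bar R) : (forall x, 0 <= g x)%E ->
    (0 <= \int[mu]_(x in phi @^-1` D) g (a * x + b)%R)%E.
  by move=> g0; exact: integral_ge0.
have := ge0 f^\+%E (funepos_ge0 _); have := ge0 f^\-%E (funeneg_ge0 _).
rewrite [in RHS]funepos_comp [in RHS]funeneg_comp /=.
case: integral => [x| |]// _; case: integral => [y| |]// _; rewrite ?gt0_muley ?lte_fin ?normr_gt0//=
  ?gt0_muleNy ?lte_fin ?normr_gt0//.
by rewrite -!EFinM -!EFinB -mulrBr.
Qed.

Lemma Rintegral_affine (D : set R) (f : R -> R) : measurable D ->
  measurable_fun D f ->
  \int[mu]_(x in D) f x = `|a| * \int[mu]_(x in phi @^-1` D) f (a * x + b).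
Proof.
move=> mD mf; rewrite /Rintegral integral_affine//; last exact/measurable_EFinP.
case: integral => [x| |]//=.
- by rewrite gt0_muley ?lte_fin ?normr_gt0// mulr0.
- by rewrite gt0_muleNy ?lte_fin ?normr_gt0// mulr0.
Qed.

End affine_change_of_variable.

(** Monotone limit of integrals over compact intervals away from 0, each computed from the
    antiderivative x^b / b. *)
Lemma integral_powR01 {R : realType} (b : R) : 0 < b ->
  (\int[mu]_(x in `]0%R, 1%R]) (x `^ (b - 1))%:E <= (b^-1)%:E)%E.
Proof.
(* The shift to [i.+2] keeps the left endpoint strictly below 1, as the fundamental theorem of
   calculus requires. *)
move=> b0; pose F (i : nat) : set R := `[i.+2%:R^-1, 1]%classic.
have F0 i x : F i x -> 0 < x.
  by rewrite /F/= in_itv/= => /andP[+ _]; apply: lt_le_trans; rewrite invr_gt0 ltr0n.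
have -> : `]0, 1]%classic = \bigcup_i F i.
  apply/seteqP; split => [x|x [i _ Fix]]; last first.
    by have := F0 _ _ Fix; move: Fix; rewrite /F/= !in_itv/= => /andP[_ ->] ->.
  rewrite /= in_itv/= => /andP[x0 x1].
  have [k] := ltr_add_invr x0; rewrite add0r => kx.
  exists k => //; rewrite /F/= in_itv/= x1 andbT (le_trans _ (ltW kx))//.
  by rewrite lef_pV2 ?posrE ?ltr0n// ler_nat.
have mpow D : measurable_fun D (fun x : R => (x `^ (b - 1))%:E).
  by apply/measurable_EFinP/measurable_funTS; exact: measurable_powR.
have cv : (\int[mu]_(x in F i) (x `^ (b - 1))%:E @[i --> \oo] -->
   \int[mu]_(x in \bigcup_i F i) (x `^ (b - 1))%:E)%E.
  apply: ge0_nondecreasing_set_cvg_integral => //.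
  - apply/nondecreasing_seqP => n; rewrite subsetEset => x; rewrite /F/= !in_itv/= => /andP[+ ->].
    rewrite andbT; apply: le_trans; by rewrite lef_pV2 ?posrE ?ltr0n// ler_nat.
  - by move=> i; exact: measurable_itv.
  - by move=> i; exact: mpow.
  - by move=> i x _; rewrite lee_fin powR_ge0.
rewrite -(cvg_lim (@ereal_hausdorff R) cv).
apply: lime_le; first exact: (cvgP _ cv).
apply: nearW => i; rewrite /F.
have i0 : 0 < i.+2%:R^-1 :> R by rewrite invr_gt0 ltr0n.
have i1 : i.+2%:R^-1 < 1 :> R by rewrite invf_lt1 ?ltr0n// ltr1n.
rewrite (@continuous_FTC2 _ _ (fun x => b^-1 * x `^ b) _ _ i1).
- by rewrite powR1 mulr1 -EFinB lee_fin gerBl mulr_ge0 ?powR_ge0// invr_ge0 ltW.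
- apply: continuous_in_subspaceT => x; rewrite inE/= in_itv/= => /andP[ix _].
  apply: differentiable_continuous; apply/derivable1_diffP.
  by apply: derivable_powR; rewrite in_itv/= andbT (lt_le_trans i0).
- have dx x : 0 < x -> derivable (fun x => b^-1 * x `^ b) x 1.
    by move=> x0; apply: derivableM => //; apply: derivable_powR; rewrite in_itv/= andbT.
  have cx x : 0 < x -> {for x, continuous (fun x => b^-1 * x `^ b)}.
    by move=> x0; apply: differentiable_continuous; apply/derivable1_diffP; exact: dx.
  split.
  + by move=> x; rewrite in_itv/= => /andP[ix _]; apply: dx; exact: lt_trans ix.
  + by apply: cvg_at_right_filter; exact: cx.
  + by apply: cvg_at_left_filter; exact: cx.
- move=> x; rewrite in_itv/= => /andP[ix _].
  have x0 : 0 < x by exact: lt_trans ix.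
  rewrite derive1Ml; last by apply: derivable_powR; rewrite in_itv/= andbT.
  by rewrite powR_derive1 ?in_itv/= ?andbT// mulKf// gt_eqF.
Qed.

(** The inequality x <= e^x at x = e t / p, raised to the power p. *)
Lemma powR_le_expR {R : realType} (p e t : R) : 0 < p -> 0 < e -> 0 <= t ->
  t `^ p <= (p / e) `^ p * expR (e * t).
Proof.
move=> p0 e0 t0.
have pe0 : 0 < p / e by exact: divr_gt0.
have h : t <= p / e * expR (e * t / p).
  rewrite -ler_pdivrMl// invf_div mulrAC.
  by rewrite (le_trans _ (expR_ge1Dx _))// lerDr.
apply: (@le_trans _ _ ((p / e * expR (e * t / p)) `^ p)).
  by apply: ge0_ler_powR; rewrite ?nnegrE// ?ltW// mulr_gt0 ?expR_gt0.
rewrite powRM ?expR_ge0 ?(ltW pe0)// -expRM.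
by rewrite divfK ?gt_eqF.
Qed.

Lemma measurable_expRN {R : realType} (s : R) (D : set R) :
  measurable_fun D (fun t : R => expR (- (s * t))).
Proof.
apply: measurable_funTS; apply: measurableT_comp => //.
by apply: measurableT_comp => //; exact: measurable_funM.
Qed.

(** Read off from the total mass 1 of the exponential density of rate [s]. *)
Lemma integral_expRN {R : realType} (s : R) : 0 < s ->
  (\int[mu]_(x in `]0%R, +oo[) (expR (- (s * x)))%:E = (s^-1)%:E)%E.
Proof.
move=> s0.
have mE D (c : R) : measurable_fun D (fun x => (c * expR (- (s * x)))%:E).
  by apply/measurable_EFinP; apply: measurable_funM => //; exact: measurable_expRN.
have mE1 D : measurable_fun D (fun x => (expR (- (s * x)))%:E).
  by apply/measurable_EFinP; exact: measurable_expRN.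
have := integral_exponential_pdf s0.
have -> : (\int[mu]_x (exponential_pdf s x)%:E =
    \int[mu]_(x in `[0%R, +oo[) (s * expR (- (s * x)))%:E)%E.
  rewrite [RHS]integral_mkcond; apply: eq_integral => x _.
  by rewrite !patchE /exponential_pdf patchE -mulNr; case: ifPn.
rewrite -integral_itv_obnd_cbnd; last exact: mE.
under eq_integral do rewrite EFinM.
rewrite ge0_integralZl//; [|exact: mE1|by rewrite lee_fin ltW].
have : (0 <= \int[mu]_(x in `]0%R, +oo[) (expR (- (s * x)))%:E)%E.
  by apply: integral_ge0 => x _; rewrite lee_fin expR_ge0.
case: integral => [r| |] //; last by rewrite gt0_muley ?lte_fin.
move=> _ [sr]; congr EFin; apply: (mulfI (negbT (gt_eqF s0))).
by rewrite sr mulfV// gt_eqF.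
Qed.


Lemma measurable_powR_expRN {R : realType} (b s : R) (D : set R) :
  measurable_fun D (fun t : R => t `^ (b - 1) * expR (- (s * t))).
Proof.
apply: measurable_funM; last exact: measurable_expRN.
by apply: measurable_funTS; exact: measurable_powR.
Qed.

(** Near 0 the power alone dominates. Beyond 1, half of the exponential rate absorbs the power,
    since t^(b-1) <= t^b <= C e^(st/2), and the other half is integrable. *)
Lemma integrable_powR_expRN {R : realType} (b s : R) : 0 < b -> 0 < s ->
  mu.-integrable `]0, +oo[
    (fun t : R => (t `^ (b - 1) * expR (- (s * t)))%:E).
Proof.
move=> b0 s0.
have s20 : 0 < s / 2 by rewrite divr_gt0.
pose g1 := (fun t : R => (t `^ (b - 1))%:E) \_ `]0, 1].
pose C := (b / (s / 2)) `^ b.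
pose g2 := (fun t : R => (expR (- (s / 2 * t)))%:E).
have ig1 : mu.-integrable `]0, +oo[ g1.
  suff : mu.-integrable setT g1 by apply: integrableS => //; exact: measurable_itv.
  apply/(integrable_mkcond _ _).1; first exact: measurable_itv.
  apply/integrableP; split.
    by apply/measurable_EFinP/measurable_funTS; exact: measurable_powR.
  under eq_integral do rewrite gee0_abs ?lee_fin ?powR_ge0//.
  by apply: (@le_lt_trans _ _ (b^-1)%:E); [exact: integral_powR01|rewrite ltry].
have ig2 : mu.-integrable `]0, +oo[ g2.
  apply/integrableP; split.
    by apply/measurable_EFinP; exact: measurable_expRN.
  under eq_integral do rewrite gee0_abs ?lee_fin ?expR_ge0//.
  by rewrite integral_expRN// ltry.
have ig : mu.-integrable `]0, +oo[ (g1 \+ (fun t => C%:E * g2 t))%E.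
  by apply: integrableD => //; exact: integrableZl.
apply: le_integrable ig => //.
- by apply/measurable_EFinP; exact: measurable_powR_expRN.
move=> t /=; rewrite in_itv/= andbT => t0.
rewrite /g1 patchE; have [t1|t1] := leP t 1.
  rewrite ifT; last by rewrite inE/= in_itv/= t0.
  rewrite lee_fin !ger0_norm ?addr_ge0 ?mulr_ge0 ?powR_ge0 ?expR_ge0//.
  rewrite (@le_trans _ _ (t `^ (b - 1)))//.
    rewrite ler_piMr ?powR_ge0// expR_le1 oppr_le0 mulr_ge0// ltW//.
  by rewrite lerDl mulr_ge0 ?powR_ge0 ?expR_ge0.
rewrite ifF; last by apply/negP; rewrite inE/= in_itv/= t0/= leNgt t1.
rewrite add0e lee_fin !ger0_norm ?mulr_ge0 ?powR_ge0 ?expR_ge0//.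
have -> : expR (- (s * t)) = expR (- (s / 2 * t)) * expR (- (s / 2 * t)).
  by rewrite -expRD; congr expR; field.
rewrite mulrA ler_pM2r ?expR_gt0// expRN ler_pdivrMr ?expR_gt0//.
have h : t `^ (b - 1) <= t `^ b by apply: ler_powR; [exact: ltW|rewrite gerBl].
by rewrite (le_trans h)//; apply: powR_le_expR => //; exact: ltW.
Qed.

Lemma Gamma_scale {R : realType} (b s : R) : 0 < b -> 0 < s ->
  \int[mu]_(t in `]0, +oo[) (t `^ (b - 1) * expR (- (s * t))) =
  Gamma_function b * s `^ (- b).
Proof.
move=> b0 s0; have s10 : 0 < s^-1 by rewrite invr_gt0.
rewrite (Rintegral_affine 0 (lt0r_neq0 s10)); [rewrite gtr0_norm//|
  exact: measurable_itv|exact: measurable_powR_expRN].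
have -> : (fun x : R => s^-1 * x + 0) @^-1` `]0, +oo[ = `]0, +oo[%classic.
  by apply/seteqP; split => x /=; rewrite !in_itv/= !andbT addr0 pmulr_rgt0.
rewrite /Gamma_function -RintegralZr//; last first.
  have := integrable_powR_expRN b0 ltr01.
  by apply: eq_integrable => // x _ /=; rewrite mul1r.
rewrite -RintegralZl//; last first.
  have : mu.-integrable `]0, +oo[ (fun x : R => (s `^ (1 - b))%:E * (x `^ (b - 1) * expR (- (1 * x)))%:E)%E.
    by apply: integrableZl => //; exact: integrable_powR_expRN.
  apply: eq_integrable => //.
  move=> x; rewrite inE/= in_itv/= andbT => x0.
  rewrite -EFinM addr0 mulVKf ?gt_eqF// mul1r powRM ?(ltW x0) ?(ltW s10)// -mulrA.
  by congr (_ * _)%:E; rewrite -powR_inv1 ?(ltW s0)// -powRrM mulN1r opprB.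
apply: eq_Rintegral => x; rewrite inE/= in_itv/= andbT => x0.
rewrite addr0 mulVKf ?gt_eqF// powRM ?(ltW x0) ?(ltW s10)//.
have -> : s `^ (- b) = s^-1 * s^-1 `^ (b - 1).
  rewrite mulr_powRB1 ?(ltW s10)// -powR_inv1 ?(ltW s0)// -powRrM.
  by rewrite mulN1r.
ring.
Qed.

(** The Gamma integral is restricted to [x, x + 1]. There u^(b-1) = u^b / u with u >= x in the
    numerator and u <= x + 1 <= 2x in the denominator, which gives the factor 1/2 whatever the sign
    of b - 1. *)
Lemma Gamma_lower_bound {R : realType} (b x : R) : 0 < b -> 1 <= x ->
  x `^ (b - 1) / 2 * expR (- (x + 1)) <= Gamma_function b.
Proof.
move=> b0 x1; have x0 : 0 < x by exact: lt_le_trans x1.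
have ig : mu.-integrable `]0, +oo[ (fun t : R => (t `^ (b - 1) * expR (- t))%:E).
  have := integrable_powR_expRN b0 ltr01.
  by apply: eq_integrable => // t _ /=; rewrite mul1r.
have mE (E : set R) : measurable_fun E (fun t : R => (t `^ (b - 1) * expR (- t))%:E).
  apply/measurable_EFinP; have := @measurable_powR_expRN R b 1 E.
  by apply: eq_measurable_fun => t _; rewrite mul1r.
have fG := integrable_fin_num _ ig.
rewrite -lee_fin /Gamma_function /Rintegral fineK; last exact: fG.
set c := _ / 2 * _.
have c0 : 0 <= c by rewrite !mulr_ge0 ?powR_ge0 ?expR_ge0.
have xx : `[x, x + 1]%classic `<=` `]0, +oo[%classic.
  by move=> u /=; rewrite !in_itv/= andbT => /andP[xu _]; exact: lt_le_trans xu.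
apply: (@le_trans _ _ (\int[mu]_(t in `[x, (x + 1)%R]) c%:E)%E).
  rewrite integral_cst//= lebesgue_measure_itv/= lte_fin ltrDl ltr01.
  by rewrite -EFinD addrAC subrr add0r mule1.
apply: (@le_trans _ _ (\int[mu]_(t in `[x, (x + 1)%R]) (t `^ (b - 1) * expR (- t))%:E)%E).
  apply: ge0_le_integral => //.
  - exact: mE.
  - move=> u /=; rewrite in_itv/= => /andP[xu ux]; rewrite lee_fin.
    have u0 : 0 < u by exact: lt_le_trans xu.
    apply: ler_pM; rewrite ?expR_ge0 ?mulr_ge0 ?powR_ge0//; last first.
      by rewrite ler_expR lerN2.
    have E (v : R) : 0 < v -> v `^ (b - 1) = v `^ b / v.
      by move=> v0; rewrite -[in LHS](addrC (- 1)) powRD ?(gt_eqF v0) ?implybT// powR_inv1 ?ltW// mulrC.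
    rewrite !E// -mulrA -invfM; apply: ler_pM; rewrite ?powR_ge0 ?invr_ge0//.
    + by rewrite mulr_ge0// ltW.
    + by apply: ge0_ler_powR; rewrite ?nnegrE// ltW.
    + rewrite lef_pV2 ?posrE ?mulr_gt0// (le_trans ux)// mulr2n mulrDr mulr1 lerD2l//.
apply: ge0_subset_integral => //.
- by apply: (measurable_int mu); exact: ig.
- by move=> u _; rewrite lee_fin mulr_ge0 ?powR_ge0 ?expR_ge0.
Qed.

Lemma Gamma_gt0 {R : realType} (b : R) : 0 < b -> 0 < Gamma_function b.
Proof.
move=> b0; apply: lt_le_trans (Gamma_lower_bound b0 (lexx 1)).
by rewrite powR1 mulr_gt0 ?expR_gt0// divr_gt0.
Qed.

(* [Gamma b] is bounded below by the part of its integral over [x, x + 1] with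
   [x = max 1 (c * t)]: this gives geometric decay in [b] at every [t] at once. *)
Lemma powR_div_Gamma_le {R : realType} (b0 b c t : R) :
  0 < b0 -> b0 <= b -> 1 <= c -> 0 < t ->
  t `^ (b - 1) / Gamma_function b <=
  c `^ (- (b - b0)) * (2 * expR 3 * t `^ (b0 - 1) * expR (2 * c * t)).
Proof.
move=> b00 bb c1 t0; have c0 : 0 < c by exact: lt_le_trans c1.
have bp : 0 < b by exact: lt_le_trans bb.
pose x := Num.max 1 (c * t).
have x1 : 1 <= x by rewrite le_max lexx.
have x0 : 0 < x by exact: lt_le_trans x1.
have xc : c * t <= x by rewrite le_max lexx orbT.
have xle : x <= 1 + c * t.
  by rewrite ge_max lerDl lerDr ler01 mulr_ge0 ?ltW.
rewrite ler_pdivrMr ?Gamma_gt0//.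
apply: le_trans (ler_wpM2l _ (Gamma_lower_bound bp x1)); last first.
  by rewrite !mulr_ge0 ?powR_ge0 ?expR_ge0.
have E1 : t `^ (b - 1) = t `^ (b - b0) * t `^ (b0 - 1).
  by rewrite -powRD ?(gt_eqF t0) ?implybT//; congr powR; ring.
have E2 : x `^ (b - 1) = x `^ (b - b0) * (x `^ b0 / x).
  rewrite -powR_inv1 ?(ltW x0)// -!powRD ?(gt_eqF x0) ?implybT//; congr powR; ring.
have h1 : t `^ (b - b0) <= c `^ (- (b - b0)) * x `^ (b - b0).
  rewrite powRN ler_pdivlMl ?powR_gt0// -powRM ?(ltW t0) ?(ltW c0)//.
  by apply: ge0_ler_powR; rewrite ?nnegrE ?subr_ge0// ltW// mulr_gt0.
(* Origin of the constants: x <= e^x and x <= 1 + ct give x e^(x+1) <= e^(2x+1) <= e^(3+2ct). *)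
have h2 : 1 <= expR 3 * expR (2 * c * t) * expR (- (x + 1)) * (x `^ b0 / x).
  have : 1 <= x `^ b0 by rewrite -(powRr0 x); apply: ler_powR => //; exact: ltW.
  move=> xb; rewrite mulrA ler_pdivlMr// mul1r.
  apply: (@le_trans _ _ (expR x)).
    by apply: le_trans (expR_ge1Dx x); rewrite lerDr.
  rewrite -[leLHS]mulr1; apply: ler_pM; rewrite ?expR_ge0//.
  rewrite -!expRD ler_expR; move: xle; lra.
rewrite E1 E2.
apply: (@le_trans _ _ (c `^ (- (b - b0)) * x `^ (b - b0) * t `^ (b0 - 1) *
   (expR 3 * expR (2 * c * t) * expR (- (x + 1)) * (x `^ b0 / x)))).
  rewrite -[leLHS]mulr1; apply: ler_pM => //; first by rewrite mulr_ge0 ?powR_ge0.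
  by rewrite ler_wpM2r ?powR_ge0.
by rewrite le_eqVlt; apply/orP; left; apply/eqP; field; rewrite gt_eqF.
Qed.

(** * Laplace transform and convolution *)

(** The real-valued integral defaults to 0 when the extended one is infinite, so integrability is
    carried along as a separate predicate. *)
Definition laplace {R : realType} (f : R -> R) (s : R) : R :=
  \int[mu]_(t in `]0, +oo[) (f t * expR (- (s * t))).

Definition laplace_integrable {R : realType} (f : R -> R) (s : R) :=
  mu.-integrable `]0, +oo[ (fun t : R => (f t * expR (- (s * t)))%:E).

(** The working class of functions: [b] measures the singularity at 0 and [c] the exponential
    growth, so that the transform converges for s > c when b > 0. Under convolution the parameters
    [b] add up. *)
Definition tame {R : realType} (b c : R) (f : R -> R) :=
  (forall t, 0 < t -> {for t, continuous f}) /\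
  exists2 M, 0 <= M &
    forall t, 0 < t -> `|f t| <= M * (t `^ (b - 1) * expR (c * t)).

Lemma tame_measurable {R : realType} (b c : R) (f : R -> R) : tame b c f ->
  measurable_fun (`]0, +oo[%classic : set R) f.
Proof.
move=> [cf _]; apply: open_continuous_measurable_fun; first exact: interval_open.
by move=> t; rewrite inE/= in_itv/= andbT => t0; exact: cf.
Qed.

Lemma tame_laplace_integrable {R : realType} (b c s : R) (f : R -> R) :
  0 < b -> c < s -> tame b c f -> laplace_integrable f s.
Proof.
move=> b0 cs tf; have [_ [M M0 fM]] := tf.
have sc0 : 0 < s - c by rewrite subr_gt0.
have ig : mu.-integrable `]0, +oo[
    (fun t : R => M%:E * (t `^ (b - 1) * expR (- ((s - c) * t)))%:E)%E.
  by apply: integrableZl => //; exact: integrable_powR_expRN.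
apply: le_integrable ig => //.
  apply/measurable_EFinP; apply: measurable_funM; first exact: (tame_measurable tf).
  exact: measurable_expRN.
move=> t /=; rewrite in_itv/= andbT => t0; rewrite lee_fin normrM.
rewrite [X in _ * X]ger0_norm ?expR_ge0// [leRHS]ger0_norm; last first.
  by rewrite !mulr_ge0 ?powR_ge0 ?expR_ge0.
have -> : expR (- ((s - c) * t)) = expR (c * t) * expR (- (s * t)).
  by rewrite -expRD; congr expR; ring.
by rewrite [_ `^ _ * _]mulrA [leRHS]mulrA ler_wpM2r ?expR_ge0// fM.
Qed.

(** At each u one of u and 1 - u is at least 1/2, and the power of that one is at most 2 by [key];
    twice the sum of the two single powers is therefore a majorant. *)
Lemma integrable_beta {R : realType} (b1 b2 : R) : 0 < b1 -> 0 < b2 ->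
  mu.-integrable `]0, 1[
    (fun u : R => ((1 - u) `^ (b1 - 1) * u `^ (b2 - 1))%:E).
Proof.
move=> b10 b20.
have m1 (b : R) (E : set R) : measurable_fun E (fun u : R => (1 - u) `^ (b - 1)).
  apply: measurable_funTS;
    apply: (@measurableT_comp _ _ _ _ _ _ (fun x : R => x `^ (b - 1)) _ (fun u : R => 1 - u)).
    exact: measurable_powR.
  exact: measurable_funB.
have m2 (b : R) (E : set R) : measurable_fun E (fun u : R => u `^ (b - 1)).
  by apply: measurable_funTS; exact: measurable_powR.
have i2 (b : R) : 0 < b -> mu.-integrable `]0, 1[ (fun u : R => (u `^ (b - 1))%:E).
  move=> b0; suff : mu.-integrable `]0, 1] (fun u : R => (u `^ (b - 1))%:E).
    apply: integrableS => //.
    by move=> x /=; rewrite !in_itv/= => /andP[-> /ltW].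
  apply/integrableP; split; first by apply/measurable_EFinP; exact: m2.
  under eq_integral do rewrite gee0_abs ?lee_fin ?powR_ge0//.
  by apply: (@le_lt_trans _ _ (b^-1)%:E); [exact: integral_powR01|rewrite ltry].
have i1 (b : R) : 0 < b -> mu.-integrable `]0, 1[ (fun u : R => ((1 - u) `^ (b - 1))%:E).
  move=> b0; apply/integrableP; split; first by apply/measurable_EFinP; exact: m1.
  rewrite (integral_affine 1 (_ : -1 != 0)) ?oppr_eq0 ?oner_neq0//; last first.
    by apply: measurableT_comp => //; apply/measurable_EFinP; exact: m1.
  have -> : (fun x : R => -1 * x + 1) @^-1` `]0, 1[ = `]0, 1[%classic.
    by apply/seteqP; split => x /=; rewrite !in_itv/= => /andP[? ?]; apply/andP; split; lra.
  rewrite normrN1 mul1e.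
  have /integrableP[_] := i2 _ b0.
  suff -> : (fun x : R => `|(1 - (-1 * x + 1)) `^ (b - 1)|%:E) =
            (fun x : R => `|x `^ (b - 1)|%:E) by [].
  by apply/funext => x; have -> : 1 - (-1 * x + 1) = x by ring.
have ig : mu.-integrable `]0, 1[ ((fun u : R => 2%:E * (u `^ (b2 - 1))%:E) \+
   (fun u : R => 2%:E * ((1 - u) `^ (b1 - 1))%:E))%E.
  by apply: integrableD => //; apply: integrableZl => //; [exact: i2|exact: i1].
apply: le_integrable ig => //.
  by apply/measurable_EFinP; apply: measurable_funM; [exact: m1|exact: m2].
move=> u /=; rewrite in_itv/= => /andP[u0 u1]; rewrite lee_fin.
rewrite !ger0_norm ?addr_ge0 ?mulr_ge0 ?powR_ge0//.
(* Written as v^b / v, the power is at most 1 / v <= 2 for every b > 0. *)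
have key (b v : R) : 0 < b -> v < 1 -> 1 / 2 <= v -> v `^ (b - 1) <= 2.
  move=> b0 v1 v2; have v0 : 0 < v by lra.
  rewrite powRD ?(gt_eqF v0) ?implybT// powR_inv1 ?(ltW v0)// ler_pdivrMr//.
  rewrite (@le_trans _ _ 1)//; last by lra.
  have <- : 1 `^ b = 1 :> R by rewrite powR1.
  by apply: ge0_ler_powR; rewrite ?nnegrE ?ltW.
have [u2|u2] := leP u (1 / 2).
- rewrite (@le_trans _ _ (2 * u `^ (b2 - 1)))//.
    by rewrite ler_wpM2r ?powR_ge0// key//; lra.
  by rewrite lerDl mulr_ge0 ?powR_ge0.
- rewrite mulrC (@le_trans _ _ (2 * (1 - u) `^ (b1 - 1)))//.
    by rewrite ler_wpM2r ?powR_ge0// key// ltW.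
  by rewrite lerDr mulr_ge0 ?powR_ge0.
Qed.

(** Moves t from the domain of integration into the integrand, so that continuity in t becomes
    continuity under an integral over a fixed interval. *)
Lemma convolution_rescale {R : realType} (f g : R -> R) (t : R) :
  measurable_fun (`]0, +oo[%classic : set R) f ->
  measurable_fun (`]0, +oo[%classic : set R) g -> 0 < t ->
  convolution f g t =
  t * \int[mu]_(u in `]0, 1[) (f (t * (1 - u)) * g (t * u)).
Proof.
move=> mf mg t0; rewrite /convolution (Rintegral_affine 0 (lt0r_neq0 t0)); last 2 first.
- exact: measurable_itv.
- apply: measurable_funM; last first.
    apply: measurable_funS mg => //.
    by move=> s /=; rewrite !in_itv/= => /andP[->].
  apply: (@measurable_comp _ _ _ _ _ _ (`]0, +oo[%classic : set R)) => //.
  + by move=> _ [s + <-]; rewrite /= !in_itv/= andbT subr_gt0 => /andP[].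
  + by apply: measurable_funTS; exact: measurable_funB.
rewrite gtr0_norm//; congr (_ * _).
have -> : (fun x : R => t * x + 0) @^-1` `]0, t[ = `]0, 1[%classic.
  apply/seteqP; split => x /=; rewrite !in_itv/= addr0 pmulr_rgt0// -[X in _ * x < X]mulr1;
  by rewrite ltr_pM2l.
by apply: eq_Rintegral => u _; rewrite addr0 mulrBr mulr1.
Qed.

(** After rescaling, the bound separates t from u: with a common growth rate [c] the two
    exponentials multiply to e^(ct) exactly, leaving a beta integrand in u. *)
Lemma tame_convolution_integrand {R : realType} (b1 b2 c : R) (f g : R -> R) :
  tame b1 c f -> tame b2 c g ->
  exists2 M, 0 <= M & forall t u, 0 < t -> 0 < u -> u < 1 ->
  `|f (t * (1 - u)) * g (t * u)| <=
  M * (t `^ (b1 + b2 - 2) * expR (c * t)) *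
  ((1 - u) `^ (b1 - 1) * u `^ (b2 - 1)).
Proof.
move=> [_ [M1 M10 fM]] [_ [M2 M20 gM]].
exists (M1 * M2); first exact: mulr_ge0.
move=> t u t0 u0 u1; have u10 : 0 < 1 - u by rewrite subr_gt0.
have tu : 0 < t * u by exact: mulr_gt0.
have tu1 : 0 < t * (1 - u) by exact: mulr_gt0.
rewrite normrM; apply: le_trans (ler_pM _ _ (fM _ tu1) (gM _ tu)) _ => //.
rewrite !powRM ?(ltW t0) ?(ltW u0) ?(ltW u10)//.
have -> : t `^ (b1 + b2 - 2) = t `^ (b1 - 1) * t `^ (b2 - 1).
  by rewrite -powRD ?(gt_eqF t0) ?implybT//; congr powR; ring.
have -> : expR (c * t) = expR (c * (t * (1 - u))) * expR (c * (t * u)).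
  by rewrite -expRD; congr expR; ring.
by rewrite le_eqVlt; apply/orP; left; apply/eqP; ring.
Qed.

Lemma measurable_convolution_integrand {R : realType} (f g : R -> R) (t : R) :
  measurable_fun (`]0, +oo[%classic : set R) f ->
  measurable_fun (`]0, +oo[%classic : set R) g -> 0 < t ->
  measurable_fun (`]0, 1[%classic : set R) (fun u => f (t * (1 - u)) * g (t * u)).
Proof.
move=> mf mg t0; apply: measurable_funM.
- apply: (@measurable_comp _ _ _ _ _ _ (`]0, +oo[%classic : set R)) => //.
  + by move=> _ [s + <-]; rewrite /= !in_itv/= andbT pmulr_rgt0// subr_gt0 => /andP[].
  + by apply: measurable_funTS; apply: measurable_funM => //; exact: measurable_funB.
- apply: (@measurable_comp _ _ _ _ _ _ (`]0, +oo[%classic : set R)) => //.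
  + by move=> _ [s + <-]; rewrite /= !in_itv/= andbT pmulr_rgt0// => /andP[].
Qed.

(** The sum of the two endpoint values covers both signs of [p], hence both directions of
    monotonicity. *)
Lemma powR_mono_bound {R : realType} (p a b t : R) : 0 < a -> a <= t -> t <= b ->
  t `^ p <= a `^ p + b `^ p.
Proof.
move=> a0 at_ tb; have t0 : 0 < t by exact: lt_le_trans at_.
have b0 : 0 < b by exact: lt_le_trans tb.
have [p0|p0] := leP 0 p.
  rewrite (@le_trans _ _ (b `^ p))//; last by rewrite lerDr powR_ge0.
  by apply: ge0_ler_powR; rewrite ?nnegrE ?(ltW t0) ?(ltW b0).
rewrite (@le_trans _ _ (a `^ p))//; last by rewrite lerDl powR_ge0.
rewrite -(opprK p) powRN (powRN a) lef_pV2 ?posrE ?powR_gt0//.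
by apply: ge0_ler_powR; rewrite ?nnegrE ?(ltW t0) ?(ltW a0)// oppr_ge0 ltW.
Qed.

Lemma tame_convolution_integrable {R : realType} (b1 b2 c : R) (f g : R -> R) (t : R) :
  0 < b1 -> 0 < b2 -> tame b1 c f -> tame b2 c g -> 0 < t ->
  mu.-integrable `]0, 1[ (fun u : R => (f (t * (1 - u)) * g (t * u))%:E).
Proof.
move=> b10 b20 tf tg t0; have [M M0 fg] := tame_convolution_integrand tf tg.
have ik : mu.-integrable `]0, 1[ (fun u : R => (M * (t `^ (b1 + b2 - 2) * expR (c * t)))%:E *
   ((1 - u) `^ (b1 - 1) * u `^ (b2 - 1))%:E)%E.
  by apply: integrableZl => //; exact: integrable_beta.
apply: le_integrable ik => //.
  apply/measurable_EFinP; apply: measurable_convolution_integrand => //.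
    exact: tame_measurable tf.
  exact: tame_measurable tg.
move=> u /=; rewrite in_itv/= => /andP[u0 u1]; rewrite lee_fin.
by rewrite [leRHS]ger0_norm ?fg// !mulr_ge0 ?powR_ge0 ?expR_ge0.
Qed.

Lemma tame_convolution_continuous {R : realType} (b1 b2 c : R) (f g : R -> R) :
  0 < b1 -> 0 < b2 -> tame b1 c f -> tame b2 c g ->
  forall t, 0 < t -> {for t, continuous (convolution f g)}.
Proof.
move=> b10 b20 tf tg t0 t00; have [M M0 fg] := tame_convolution_integrand tf tg.
have t2 : 0 < t0 / 2 by rewrite divr_gt0.
(* [K] bounds the factor depending on t for all t in the window from t0 / 2 to 2 t0, where
   domination is applied. *)
pose K := M * (((t0 / 2) `^ (b1 + b2 - 2) + (t0 * 2) `^ (b1 + b2 - 2)) *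
   expR (`|c| * (t0 * 2))).
pose F t := \int[mu]_(u in `]0, 1[) (f (t * (1 - u)) * g (t * u)).
have cF : {for t0, continuous F}.
  apply: (@continuity_under_integral R _ _ mu (fun t u => f (t * (1 - u)) * g (t * u))
    `]0, 1[ (measurable_itv _) (t0 / 2) (t0 * 2) _ _
    (fun u => K * ((1 - u) `^ (b1 - 1) * u `^ (b2 - 1)))).
  - move=> t; rewrite /= in_itv/= => /andP[t1 _].
    by apply: tame_convolution_integrable tf tg _ => //; exact: lt_trans t1.
  - apply: aeW => u /=; rewrite in_itv/= => /andP[u0 u1] t.
    rewrite inE/= in_itv/= => /andP[t1 _]; have tp : 0 < t by exact: lt_trans t1.
    apply: continuousM.
    + apply: (@continuous_comp _ _ _ (fun t : R => t * (1 - u)) f).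
        exact: mulrr_continuous.
      by apply: tf.1; rewrite mulr_gt0// subr_gt0.
    + apply: (@continuous_comp _ _ _ (fun t : R => t * u) g).
        exact: mulrr_continuous.
      by apply: tg.1; rewrite mulr_gt0.
  - have : mu.-integrable `]0, 1[ (fun u : R => K%:E *
      ((1 - u) `^ (b1 - 1) * u `^ (b2 - 1))%:E)%E.
      by apply: integrableZl => //; exact: integrable_beta.
    by [].
  - move=> t; rewrite /= in_itv/= => /andP[t1 t2'].
    apply: aeW => u /=; rewrite in_itv/= => /andP[u0 u1].
    have tp : 0 < t by exact: lt_trans t1.
    apply: (le_trans (fg _ _ tp u0 u1)).
    rewrite ler_wpM2r ?mulr_ge0 ?powR_ge0// ler_wpM2l//.
    apply: ler_pM; rewrite ?powR_ge0 ?expR_ge0//.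
      by apply: powR_mono_bound; rewrite ?(ltW t1) ?(ltW t2').
    rewrite ler_expR (@le_trans _ _ (`|c| * t))//.
      by rewrite ler_wpM2r ?(ltW tp)// ler_norm.
    by rewrite ler_wpM2l// ltW.
  - by rewrite inE/= in_itv/=; apply/andP; split; lra.
(* The rescaled formula is available at positive times, so the limit is transported along an
   equality valid near [t0]. *)
have -> : {for t0, continuous (convolution f g)} = {for t0, continuous (fun t : R => t * F t)}.
  rewrite /prop_for /continuous_at.
  rewrite (convolution_rescale (tame_measurable tf) (tame_measurable tg) t00).
  apply/propext; split.
    apply: cvg_trans; apply: near_eq_cvg.
    near=> t; rewrite [LHS]convolution_rescale//; [exact: tame_measurable tf|
      exact: tame_measurable tg|near: t; exact: lt_nbhsr].
  apply: cvg_trans; apply: near_eq_cvg.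
  near=> t; rewrite [RHS]convolution_rescale//; [exact: tame_measurable tf|
    exact: tame_measurable tg|near: t; exact: lt_nbhsr].
by apply: continuousM => //; exact: id_continuous.
Unshelve. all: by end_near. Qed.

Lemma tame_convolution {R : realType} (b1 b2 c : R) (f g : R -> R) :
  0 < b1 -> 0 < b2 -> tame b1 c f -> tame b2 c g ->
  tame (b1 + b2) c (convolution f g).
Proof.
move=> b10 b20 tf tg; split; first exact: tame_convolution_continuous tf tg.
have [M M0 fg] := tame_convolution_integrand tf tg.
have ik := integrable_beta b10 b20.
exists (M * \int[mu]_(u in `]0, 1[) ((1 - u) `^ (b1 - 1) * u `^ (b2 - 1))).
  by rewrite mulr_ge0// Rintegral_ge0// => u _; rewrite mulr_ge0 ?powR_ge0.
move=> t t0.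
rewrite (convolution_rescale (tame_measurable tf) (tame_measurable tg) t0).
rewrite normrM gtr0_norm//.
have it := tame_convolution_integrable b10 b20 tf tg t0.
apply: (@le_trans _ _ (t * \int[mu]_(u in `]0, 1[) ((M * (t `^ (b1 + b2 - 2) * expR (c * t))) *
  ((1 - u) `^ (b1 - 1) * u `^ (b2 - 1))))).
  rewrite ler_wpM2l ?(ltW t0)//; apply: (le_trans (le_normr_Rintegral _ it)) => //.
  apply: le_Rintegral => //.
  - exact: integrable_norm.
  - have : mu.-integrable `]0, 1[ (fun u : R => (M * (t `^ (b1 + b2 - 2) * expR (c * t)))%:E *
      ((1 - u) `^ (b1 - 1) * u `^ (b2 - 1))%:E)%E.
      by apply: integrableZl => //; exact: integrable_beta.
    by [].
  - by move=> u /=; rewrite in_itv/= => /andP[u0 u1]; exact: fg.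
rewrite RintegralZl//.
have -> : t `^ (b1 + b2 - 1) = t * t `^ (b1 + b2 - 2).
  rewrite -[X in X * _](powRr1 (ltW t0)) -powRD ?(gt_eqF t0) ?implybT//.
  by congr powR; ring.
by rewrite le_eqVlt; apply/orP; left; apply/eqP; ring.
Qed.

Lemma tame_convolution_integrable0 {R : realType} (b1 b2 c : R) (f g : R -> R) (t : R) :
  0 < b1 -> 0 < b2 -> tame b1 c f -> tame b2 c g -> 0 < t ->
  mu.-integrable `]0, t[ (fun x : R => (f (t - x) * g x)%:E).
Proof.
move=> b10 b20 tf tg t0.
have mfg : measurable_fun (`]0, t[%classic : set R) (fun x : R => f (t - x) * g x).
  apply: measurable_funM; last first.
    apply: measurable_funS (tame_measurable tg) => //.
    by move=> s /=; rewrite !in_itv/= => /andP[->].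
  apply: (@measurable_comp _ _ _ _ _ _ (`]0, +oo[%classic : set R)) => //.
  + by move=> _ [s + <-]; rewrite /= !in_itv/= andbT subr_gt0 => /andP[].
  + exact: tame_measurable tf.
  + by apply: measurable_funTS; exact: measurable_funB.
apply/integrableP; split; first exact/measurable_EFinP.
rewrite (integral_affine 0 (lt0r_neq0 t0))//; last first.
  by apply: measurableT_comp => //; exact/measurable_EFinP.
have -> : (fun x : R => t * x + 0) @^-1` `]0, t[ = `]0, 1[%classic.
  apply/seteqP; split => x /=; rewrite !in_itv/= addr0 pmulr_rgt0// -[X in _ * x < X]mulr1;
  by rewrite ltr_pM2l.
have /integrableP[_ h] := tame_convolution_integrable b10 b20 tf tg t0.
have -> : (fun x : R => `|(f (t - (t * x + 0)) * g (t * x + 0))|%:E) =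
  (fun x : R => `|f (t * (1 - x)) * g (t * x)|%:E).
  by apply/funext => x; rewrite addr0 mulrBr mulr1.
by rewrite lte_mul_pinfty.
Qed.

Lemma integral_translate {R : realType} (x : R) (h : R -> \bar R) :
  measurable_fun setT h ->
  (\int[mu]_t h (t - x)%R = \int[mu]_t h t)%E.
Proof.
move=> mh; rewrite [RHS](integral_affine (- x) (oner_neq0 _))//.
rewrite normr1 mul1e preimage_setT.
by apply: eq_integral => t _; rewrite mul1r.
Qed.

(** Stated on the whole line, where translation invariance makes the inner integral independent of
    the shift. Tonelli applied to absolute values gives the product of the two L1 norms, hence joint
    integrability. *)
Lemma Fubini_convolution {R : realType} (F G : R -> R) :
  mu.-integrable setT (EFin \o F) -> mu.-integrable setT (EFin \o G) ->
  (\int[mu]_t \int[mu]_x (F (t - x) * G x)%:E =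
   (\int[mu]_t F t * \int[mu]_t G t)%:E)%E.
Proof.
move=> iF iG.
have /measurable_EFinP mF := measurable_int _ iF.
have /measurable_EFinP mG := measurable_int _ iG.
pose h := (fun z : R * R => (F (z.1 - z.2) * G z.2)%:E).
have mh : measurable_fun setT h.
  apply/measurable_EFinP; apply: measurable_funM.
    by apply: measurableT_comp => //; exact: measurable_funB.
  exact: measurableT_comp.
have mFx x : measurable_fun setT (fun t : R => F (t - x)).
  by apply: (measurableT_comp mF); exact: measurable_funB.
have iFx x : mu.-integrable setT (fun t : R => (F (t - x))%:E).
  have /integrableP[_ h1] := iF.
  apply/integrableP; split; first by apply/measurable_EFinP; exact: mFx.
  rewrite (@integral_translate _ x (fun t => `|(F t)%:E|%E))//.
  by apply: measurableT_comp => //; exact/measurable_EFinP.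
have ih : (mu \x mu)%E.-integrable setT h.
  apply/(integrable21ltyP lebesgue_measure lebesgue_measure mh).
  have -> : (\int[mu]_y \int[mu]_x `|h (x, y)| =
      \int[mu]_y (`|G y|%:E * \int[mu]_x `|(F x)%:E|))%E.
    apply: eq_integral => y _; rewrite -(@integral_translate _ y (fun t => `|(F t)%:E|%E)); last first.
      by apply: measurableT_comp => //; exact/measurable_EFinP.
    rewrite -ge0_integralZl//; last first.
      by apply: measurableT_comp => //; apply/measurable_EFinP; exact: mFx.
    by apply: eq_integral => x _; rewrite /h/= normrM mulrC EFinM.
  have /integrableP[_ h1] := iF.
  have /integrableP[_ h2] := iG.
  rewrite ge0_integralZr//; last 2 first.
  - by apply/measurable_EFinP; apply: measurableT_comp => //; exact: mG.
  - by apply: integral_ge0 => x _; exact: abse_ge0.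
  by rewrite lte_mul_pinfty// ?integral_ge0// ge0_fin_numE// integral_ge0.
have := Fubini ih; rewrite /h/= => ->.
have -> : (\int[mu]_y \int[mu]_x (F (x - y) * G y)%:E =
     \int[mu]_y ((G y)%:E * \int[mu]_x (F x)%:E))%E.
  apply: eq_integral => y _.
  rewrite -(@integral_translate _ y (EFin \o F))//; last exact/measurable_EFinP.
  rewrite -integralZl//; last exact: iFx.
  by apply: eq_integral => x _; rewrite /= mulrC EFinM.
rewrite /Rintegral EFinM !fineK; [|exact: integrable_fin_num iG|exact: integrable_fin_num iF].
rewrite -[in LHS](@fineK _ (\int[mu]_x (F x)%:E)%E); last exact: integrable_fin_num iF.
by rewrite integralZr// fineK ?(integrable_fin_num _ iF)// muleC.
Qed.

(** Both integrands are extended by 0 to the line. Since e^(-st) = e^(-s(t-x)) e^(-sx), the weight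
    splits between the factors, and the zero extensions confine x to ]0, t[. *)
Lemma laplace_convolution {R : realType} (b1 b2 c s : R) (f g : R -> R) :
  0 < b1 -> 0 < b2 -> c < s -> tame b1 c f -> tame b2 c g ->
  laplace (convolution f g) s = laplace f s * laplace g s.
Proof.
move=> b10 b20 cs tf tg.
pose F := (fun t => f t * expR (- (s * t))) \_ `]0, +oo[.
pose G := (fun t => g t * expR (- (s * t))) \_ `]0, +oo[.
have out (k : R -> R) (x : R) : x <= 0 -> (k \_ `]0, +oo[) x = 0.
  move=> x0; rewrite patchE ifF//; apply/negP.
  by rewrite inE/= in_itv/= andbT ltNge x0.
have iF : mu.-integrable setT (EFin \o F).
  rewrite /F -restrict_EFin; apply/(integrable_mkcond _ _).1; first exact: measurable_itv.
  exact: tame_laplace_integrable tf.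
have iG : mu.-integrable setT (EFin \o G).
  rewrite /G -restrict_EFin; apply/(integrable_mkcond _ _).1; first exact: measurable_itv.
  exact: tame_laplace_integrable tg.
rewrite /laplace [X in _ = X * _]Rintegral_mkcond [X in _ = _ * X]Rintegral_mkcond.
apply: EFin_inj; rewrite -(Fubini_convolution iF iG).
have ic : laplace_integrable (convolution f g) s.
  apply: (@tame_laplace_integrable _ (b1 + b2) c); rewrite ?addr_gt0//.
  exact: tame_convolution.
rewrite /Rintegral fineK; last exact: (integrable_fin_num _ ic).
rewrite integral_mkcond; apply: eq_integral => t _.
rewrite patchE; case: ifPn => [|tN].
- rewrite inE/= in_itv/= andbT => t0.
  have i0 := tame_convolution_integrable0 b10 b20 tf tg t0.
  transitivity (\int[mu]_(x in `]0%R, t[) ((expR (- (s * t)))%:E * (f (t - x) * g x)%:E))%E.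
    rewrite integralZl// EFinM muleC; congr (_ * _)%E.
    by rewrite /convolution /Rintegral fineK//; exact: integrable_fin_num i0.
  rewrite [LHS]integral_mkcond; apply: eq_integral => x _.
  rewrite patchE; case: ifPn => [|xN].
    rewrite inE/= in_itv/= => /andP[x0 xt].
    rewrite /F /G !patchE !ifT ?inE/= ?in_itv/= ?x0 ?subr_gt0 ?xt//.
    rewrite -EFinM; congr EFin; have -> : expR (- (s * t)) = expR (- (s * (t - x))) * expR (- (s * x)).
      by rewrite -expRD; congr expR; ring.
    ring.
  have [x0|x0] := leP x 0; first by rewrite /G (out _ _ x0) mulr0.
  rewrite /F out ?mul0r// subr_le0 leNgt; apply/negP => xt.
  by move/negP : xN; apply; rewrite inE/= in_itv/= x0.
- rewrite -[LHS](@integral0 _ _ _ mu setT); apply: eq_integral => x _.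
  have [x0|x0] := leP x 0; first by rewrite /G (out _ _ x0) mulr0.
  rewrite /F out ?mul0r// subr_le0 leNgt; apply/negP => xt.
  by move/negP : tN; apply; rewrite inE/= in_itv/= andbT (lt_trans x0).
Qed.

Lemma laplace_linear {R : realType} (F G : R -> R) (x y s : R) :
  laplace_integrable F s -> laplace_integrable G s ->
  laplace_integrable (fun t => x * F t + y * G t) s /\
  laplace (fun t => x * F t + y * G t) s = x * laplace F s + y * laplace G s.
Proof.
move=> iF iG.
have ixF : mu.-integrable `]0, +oo[ (fun t => (x * (F t * expR (- (s * t))))%:E).
  have : mu.-integrable `]0, +oo[ (fun t => x%:E * (F t * expR (- (s * t)))%:E)%E.
    by apply: integrableZl => //; exact: iF.
  by [].
have iyG : mu.-integrable `]0, +oo[ (fun t => (y * (G t * expR (- (s * t))))%:E).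
  have : mu.-integrable `]0, +oo[ (fun t => y%:E * (G t * expR (- (s * t)))%:E)%E.
    by apply: integrableZl => //; exact: iG.
  by [].
have E t : (x * F t + y * G t) * expR (- (s * t)) =
  x * (F t * expR (- (s * t))) + y * (G t * expR (- (s * t))) by rewrite mulrDl !mulrA.
split.
  rewrite /laplace_integrable.
  have -> : (fun t => ((x * F t + y * G t) * expR (- (s * t)))%:E) =
    ((fun t => (x * (F t * expR (- (s * t))))%:E) \+
     (fun t => (y * (G t * expR (- (s * t))))%:E))%E.
    by apply/funext => t; rewrite E.
  exact: integrableD.
rewrite /laplace; under eq_Rintegral do rewrite E.
by rewrite RintegralD// !RintegralZl.
Qed.

(** The Weierstrass test with an explicit remainder. The factor [g] is kept apart from the summable
    sequence so that, when it depends on a parameter, the remainder is uniform wherever [g] is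
    bounded. *)
Lemma dominated_series {R : realType} (u m : R^nat) (g : R) : 0 <= g ->
  (forall k, 0 <= m k) -> (forall k, `|u k| <= m k * g) -> cvgn (series m) ->
  cvgn (series u) /\
  forall n, `|limn (series u) - series u n| <= (limn (series m) - series m n) * g.
Proof.
move=> g0 m0 um cm.
have cmg : cvgn (series (g *: m)) by exact: is_cvg_seriesZ.
have cu : cvgn (series u).
  apply: normed_cvg; apply: series_le_cvg cmg => k.
  - exact: normr_ge0.
  - by rewrite mulr_ge0.
  - by rewrite [leRHS]mulrC um.
split=> // n.
have ndm : nondecreasing_seq (series m).
  by apply/nondecreasing_seqP => k; rewrite seriesSr lerDl m0.
have cun : `|series u N - series u n| @[N --> \oo] --> `|limn (series u) - series u n|.
  by apply: cvg_norm; apply: cvgB => //; exact: cvg_cst.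
rewrite -(cvg_lim _ cun)//; apply: limr_le; first exact: (cvgP _ cun).
near=> N; have nN : (n <= N)%N by near: N; exact: nbhs_infty_ge.
rewrite sub_series_geq//; apply: (le_trans (ler_norm_sum _ _ _)).
apply: (@le_trans _ _ ((series m N - series m n) * g)).
  rewrite sub_series_geq// mulr_suml; apply: ler_sum => k _; exact: um.
by rewrite ler_wpM2r// lerD2r; exact: nondecreasing_cvgn_le.
Unshelve. all: by end_near. Qed.

(** The same [b] and [c] dominate all terms, so partial sums converge uniformly on a window around
    each positive point; continuity follows by splitting the error in three. *)
Lemma tame_series {R : realType} (b c : R) (u : nat -> R -> R) (m : R^nat) :
  (forall k, 0 <= m k) -> cvgn (series m) ->
  (forall k t, 0 < t -> {for t, continuous (u k)}) ->
  (forall k t, 0 < t -> `|u k t| <= m k * (t `^ (b - 1) * expR (c * t))) ->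
  tame b c (fun t => limn (series (fun k => u k t))).
Proof.
move=> m0 cm cu um.
have g0 t : 0 <= t `^ (b - 1) * expR (c * t) :> R by rewrite mulr_ge0 ?powR_ge0 ?expR_ge0.
have tail t n : 0 < t -> `|limn (series (fun k => u k t)) - series (fun k => u k t) n| <=
    (limn (series m) - series m n) * (t `^ (b - 1) * expR (c * t)).
  by move=> t0; have [_] := dominated_series (g0 t) m0 (fun k => um k t t0) cm; exact.
split=> [t0 t00|]; last first.
  exists (limn (series m)).
    by apply: limr_ge => //; apply: nearW => n; rewrite /series/= sumr_ge0.
  by move=> t t0; have := tail t 0%N t0; rewrite /series/= !big_geq// !subr0.
apply/cvgrPdist_lt => e e0.
have t2 : 0 < t0 / 2 by rewrite divr_gt0.
pose K := ((t0 / 2) `^ (b - 1) + (t0 * 2) `^ (b - 1)) * expR (`|c| * (t0 * 2)).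
have K0 : 0 <= K by rewrite mulr_ge0 ?expR_ge0 ?addr_ge0 ?powR_ge0.
have gK t : t0 / 2 < t -> t < t0 * 2 -> t `^ (b - 1) * expR (c * t) <= K.
  move=> t1 t2'; have tp : 0 < t by exact: lt_trans t1.
  apply: ler_pM; rewrite ?powR_ge0 ?expR_ge0//.
    by apply: powR_mono_bound; rewrite ?(ltW t1) ?(ltW t2').
  rewrite ler_expR (@le_trans _ _ (`|c| * t))//.
    by rewrite ler_wpM2r ?(ltW tp)// ler_norm.
  by rewrite ler_wpM2l// ltW.
(* Dividing by [K + 1] covers the case where [K] is 0. *)
have e3 : 0 < e / 3 / (K + 1) by rewrite !divr_gt0// ltr_wpDl.
have [n nP] : exists n, limn (series m) - series m n < e / 3 / (K + 1).
  have /cvgrPdist_lt /(_ _ e3) [n _ nP] := cm.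
  by exists n; apply: le_lt_trans (nP n (leqnn n)); exact: ler_norm.
have tailn t : t0 / 2 < t -> t < t0 * 2 ->
    `|limn (series (fun k => u k t)) - series (fun k => u k t) n| <= e / 3.
  move=> t1 t2'; apply: (le_trans (tail _ n (lt_trans t2 t1))).
  apply: (@le_trans _ _ (e / 3 / (K + 1) * K)).
    apply: ler_pM => //; last exact: gK.
    by rewrite subr_ge0; apply: nondecreasing_cvgn_le => //;
      apply/nondecreasing_seqP => k; rewrite seriesSr lerDl m0.
    exact: ltW.
  by rewrite -mulrA ler_piMr ?divr_ge0 ?(ltW e0)// mulrC ler_pdivrMr ?ltr_wpDl// mul1r lerDl.
have cS : {for t0, continuous (fun t => series (fun k => u k t) n)}.
  rewrite /series/=; elim: n {nP tailn} => [|n IH].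
    rewrite (_ : (fun t => _) = cst 0); last by apply/funext => t; rewrite big_geq.
    exact: cst_continuous.
  rewrite (_ : (fun t => _) = (fun t => \sum_(0 <= k < n) u k t) \+ u n); last first.
    by apply/funext => t; rewrite big_nat_recr.
  by apply: continuousD => //; exact: cu.
have e30 : 0 < e / 3 by rewrite divr_gt0.
have /cvgrPdist_lt /(_ _ e30) cSe := cS.
near=> t.
have t1 : t0 / 2 < t by near: t; apply: lt_nbhsr; lra.
have t2' : t < t0 * 2 by near: t; apply: lt_nbhsl; lra.
have h1 := tailn t t1 t2'.
have h0 : `|limn (series (fun k => u k t0)) - series (fun k => u k t0) n| <= e / 3.
  by apply: tailn; lra.
have h2 : `|series (fun k => u k t0) n - series (fun k => u k t) n| < e / 3 by near: t.
rewrite distrC in h1.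
set U0 := limn _ in h0 *; set S0 := series _ n in h0 h2 *.
set U1 := limn _ in h1 *; set S1 := series _ n in h1 h2 *.
have -> : U0 - U1 = (U0 - S0) + (S0 - S1) + (S1 - U1) by ring.
apply: (le_lt_trans (ler_normD _ _)).
have := ler_normD (U0 - S0) (S0 - S1).
move: h0 h1 h2; lra.
Unshelve. all: by end_near. Qed.

Lemma laplace_sum {R : realType} (u : nat -> R -> R) (s : R) (n : nat) :
  (forall k, laplace_integrable (u k) s) ->
  laplace_integrable (fun t => \sum_(0 <= k < n) u k t) s /\
  laplace (fun t => \sum_(0 <= k < n) u k t) s = \sum_(0 <= k < n) laplace (u k) s.
Proof.
move=> iu; elim: n => [|n [i1 i2]].
  have -> : (fun t => \sum_(0 <= k < 0) u k t) = cst 0 by apply/funext => t; rewrite big_geq.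
  rewrite /laplace_integrable /laplace.
  have -> : (fun t : R => cst 0 t * expR (- (s * t))) = cst 0.
    by apply/funext => t; rewrite mul0r.
  have -> : (fun t : R => (cst 0 t * expR (- (s * t)))%:E) = cst 0%E.
    by apply/funext => t; rewrite mul0r.
  by rewrite big_geq// /Rintegral integral0; split=> //; exact: integrable0.
have E : (fun t => (\sum_(0 <= k < n.+1) u k t) * expR (- (s * t))) =
    (fun t => (\sum_(0 <= k < n) u k t) * expR (- (s * t)) + u n t * expR (- (s * t))).
  by apply/funext => t; rewrite big_nat_recr//= mulrDl.
split.
  rewrite /laplace_integrable.
  have -> : (fun t => ((\sum_(0 <= k < n.+1) u k t) * expR (- (s * t)))%:E) =
    ((fun t => ((\sum_(0 <= k < n) u k t) * expR (- (s * t)))%:E) \+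
    (fun t => (u n t * expR (- (s * t)))%:E))%E.
    by apply/funext => t; rewrite big_nat_recr//= mulrDl.
  by apply: integrableD => //; exact: iu.
rewrite {1}/laplace E RintegralD//; last exact: iu.
by rewrite big_nat_recr//= -i2.
Qed.

(** Dominated convergence: every partial sum, times e^(-st), is below the sum of the [m k] times
    t^(b-1) e^(-(s-c)t), integrable because s > c. *)
Lemma laplace_series {R : realType} (b c s : R) (u : nat -> R -> R) (m : R^nat) :
  0 < b -> c < s ->
  (forall k, 0 <= m k) -> cvgn (series m) ->
  (forall k t, 0 < t -> {for t, continuous (u k)}) ->
  (forall k t, 0 < t -> `|u k t| <= m k * (t `^ (b - 1) * expR (c * t))) ->
  series (fun k => laplace (u k) s) @ \oo -->
  laplace (fun t => limn (series (fun k => u k t))) s.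
Proof.
move=> b0 cs m0 cm cu um.
have tu k : tame b c (u k) by split; [exact: cu|exists (m k) => //; exact: um].
have iu k : laplace_integrable (u k) s by exact: tame_laplace_integrable (tu k).
have tU := tame_series m0 cm cu um.
have iU := tame_laplace_integrable b0 cs tU.
pose f_ n (t : R) := ((\sum_(0 <= k < n) u k t) * expR (- (s * t)))%:E.
pose f (t : R) := (limn (series (fun k => u k t)) * expR (- (s * t)))%:E.
pose g (t : R) := ((limn (series m))%:E * (t `^ (b - 1) * expR (- ((s - c) * t)))%:E)%E.
have ig : mu.-integrable `]0, +oo[ g.
  by apply: integrableZl => //; apply: integrable_powR_expRN; rewrite ?subr_gt0.
have := @dominated_convergence _ _ R mu `]0, +oo[ (measurable_itv _) f_ f g _ _ _ ig _.
case=> [n| | | |_ _ cvf].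
- exact: (measurable_int _ (laplace_sum n iu).1).
- exact: (measurable_int _ iU).
- apply: aeW => t /=; rewrite in_itv/= andbT => t0.
  apply: cvg_EFin; first exact: nearW.
  apply: cvgM; last exact: cvg_cst.
  have g0 : 0 <= t `^ (b - 1) * expR (c * t) by rewrite mulr_ge0 ?powR_ge0 ?expR_ge0.
  by have [] := dominated_series g0 m0 (fun k => um k t t0) cm.
- apply: aeW => t n /=; rewrite in_itv/= andbT => t0.
  rewrite lee_fin normrM [X in _ * X]ger0_norm ?expR_ge0//.
  have -> : expR (- ((s - c) * t)) = expR (c * t) * expR (- (s * t)).
    by rewrite -expRD; congr expR; ring.
  rewrite [_ `^ _ * _]mulrA [leRHS]mulrA ler_wpM2r ?expR_ge0//.
  apply: (le_trans (ler_norm_sum _ _ _)).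
  apply: (@le_trans _ _ (series m n * (t `^ (b - 1) * expR (c * t)))).
    by rewrite /series/= mulr_suml; apply: ler_sum => k _; exact: um.
  rewrite ler_wpM2r ?mulr_ge0 ?powR_ge0 ?expR_ge0//.
  apply: nondecreasing_cvgn_le => //; apply/nondecreasing_seqP => k.
  by rewrite seriesSr lerDl m0.
have -> : series (fun k => laplace (u k) s) = fine \o (fun n => \int[mu]_(t in `]0%R, +oo[) f_ n t)%E.
  by apply/funext => n; rewrite /series/= -(laplace_sum n iu).2.
apply: fine_cvg; rewrite fineK; first exact: cvf.
exact: (integrable_fin_num _ iU).
Qed.

(** * Mittag-Leffler series *)

Lemma bin_le_exp2 (n k : nat) : ('C(n, k) <= 2 ^ n)%N.
Proof.
have [kn|kn] := leqP k n; last by rewrite bin_small.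
have := expnDn 1 1 n; rewrite addn1 => ->.
rewrite (bigD1 (Ordinal (kn : k < n.+1)%N))//= !exp1n !muln1.
exact: leq_addr.
Qed.

(** With third parameter k + 1, the coefficients of the Mittag-Leffler series become those of the
    negative binomial series. *)
Lemma rising_factorialE {R : realType} (k j : nat) :
  (\prod_(i < j) (k.+1%:R + i%:R)) / j`!%:R = 'C(k + j, j)%:R :> R.
Proof.
elim: j => [|j IH]; first by rewrite big_ord0 bin0 fact0 divr1.
have jf0 : (j`!)%:R != 0 :> R by rewrite pnatr_eq0 -lt0n fact_gt0.
have j0 : j.+1%:R != 0 :> R by rewrite pnatr_eq0.
apply: (mulfI j0); rewrite -[RHS]natrM addnS -mul_bin_diag/= natrM -IH.
rewrite big_ord_recr/= factS natrM -natrD addSn; field.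
by rewrite jf0 nat1r j0.
Qed.

(** Induction on [k]: by Pascal's rule the partial sums S for k + 1 and T for k satisfy S(n+1) =
    T(n+1) + y S(n), so (1 - y) lim S = lim T. The bound 1/4 leaves ratio 1/2 after the binomials
    are replaced by powers of 2. *)
Lemma cvg_negative_binomial {R : realType} (k : nat) (y : R) : `|y| <= 1 / 4 ->
  series (fun j => 'C(k + j, j)%:R * y ^+ j) @ \oo --> (1 - y) ^- k.+1.
Proof.
move=> y4; have y1 : 1 - y != 0.
  by rewrite subr_eq0 eq_sym lt_eqF// (le_lt_trans (ler_norm y))// (le_lt_trans y4)//; lra.
elim: k => [|k IH].
  rewrite expr1 -[X in _ --> X]mul1r.
  under eq_fun do rewrite add0n binn.
  by apply: cvg_geometric_series; apply: (le_lt_trans y4); lra.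
set S := series _.
have cS : cvgn S.
  apply: normed_cvg; pose v := geometric (2 ^+ k.+1) (2^-1 : R).
  have cv : cvgn (series v) by apply: is_cvg_geometric_series; rewrite ger0_norm// invf_lt1// ltr1n.
  apply: series_le_cvg cv => j; [exact: normr_ge0|by rewrite /v/= mulr_ge0|].
  rewrite /v/= normrM normrX ger0_norm//.
  have : `|y| ^+ j <= (1 / 4) ^+ j by rewrite lerXn2r// ?nnegrE.
  have : 'C(k.+1 + j, j)%:R <= 2 ^+ (k.+1 + j) :> R by rewrite -natrX ler_nat bin_le_exp2.
  move=> h1 h2; apply: (le_trans (ler_pM _ _ h1 h2)) => //.
  rewrite exprD -mulrA -exprMn ler_wpM2l ?exprn_ge0//.
  by rewrite le_eqVlt; apply/orP; left; apply/eqP; congr (_ ^+ _); field.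
set T := series _ in IH.
have ST n : S n.+1 = T n.+1 + y * S n.
  rewrite /S /T; elim: n => [|n IHn].
    rewrite /series/= !big_nat1 big_geq// mulr0 addr0 !addn0 !bin0.
    by [].
  have eS i : series (fun j => 'C(k.+1 + j, j)%:R * y ^+ j) i.+1 = _ := seriesSr _ i.
  have eT i : series (fun j => 'C(k + j, j)%:R * y ^+ j) i.+1 = _ := seriesSr _ i.
  rewrite (eS n.+1) [in RHS](eS n) IHn (eT n.+1).
  rewrite !addSn !addnS binS natrD (exprS y n); ring.
have cL : S n.+1 @[n --> \oo] --> limn S by rewrite (cvg_shiftS S).
have cR : T n.+1 + y * S n @[n --> \oo] --> (1 - y) ^- k.+1 + y * limn S.
  apply: cvgD; first by rewrite (cvg_shiftS T).
  by apply: cvgM => //; exact: cvg_cst.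
have E : limn S = (1 - y) ^- k.+1 + y * limn S.
  apply: (cvg_unique _ cL) => //; move: cR; apply: cvg_trans.
  by apply: near_eq_cvg; apply: nearW => n; rewrite ST.
have -> : (1 - y) ^- k.+2 = limn S.
  have h : (1 - y) * limn S = (1 - y) ^- k.+1 by rewrite mulrBl mul1r {1}E addrK.
  by apply: (mulfI y1); rewrite h exprS invfM mulVKf.
by [].
Qed.

(** The Prabhakar kernel with integer third parameter k + 1, whose transform is s^(-b) (1 + q
    s^(-a))^(-(k+1)). *)
Definition prabhakar {R : realType} (a b q : R) (k : nat) (t : R) : R :=
  t `^ (b - 1) * mittag_leffler a b k.+1%:R (- (q * t `^ a)).

(** The prefactor t^(b-1) is merged into each term, giving t^(B-1) / Gamma(B) with B = j a + b,
    whose transform is s^(-B). *)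
Definition prabhakar_term {R : realType} (a b q : R) (k j : nat) (t : R) : R :=
  'C(k + j, j)%:R * (- q) ^+ j *
  (t `^ (j%:R * a + b - 1) / Gamma_function (j%:R * a + b)).

(** [b0] is a lower exponent common to a family of kernels. The factor c^(-(b-b0)) records the gain
    from a larger [b], which later makes the sum over k converge. *)
Definition prabhakar_bound {R : realType} (b0 b c : R) (k : nat) : R^nat :=
  geometric (2 ^+ k * c `^ (- (b - b0)) * (2 * expR 3)) 2^-1.

(** The binomial is at most 2^(k+j) and the Gamma quotient contributes c^(-ja), so each step in j
    costs at most 2 q c^(-a) <= 1/2. *)
Lemma prabhakar_term_bound {R : realType} (a b0 b c q : R) (k j : nat) (t : R) :
  0 < a -> 0 < b0 -> b0 <= b -> 0 <= q -> 1 <= c -> q * c `^ (- a) <= 1 / 4 ->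
  0 < t -> `|prabhakar_term a b q k j t| <=
  prabhakar_bound b0 b c k j * (t `^ (b0 - 1) * expR (2 * c * t)).
Proof.
move=> a0 b00 bb q0 c1 qc t0.
have c0 : 0 < c by exact: lt_le_trans c1.
have ja0 : 0 <= j%:R * a by rewrite mulr_ge0// ltW.
have bj : b0 <= j%:R * a + b by rewrite (le_trans bb)// lerDr.
have G0 : 0 < Gamma_function (j%:R * a + b) by rewrite Gamma_gt0// (lt_le_trans b00).
rewrite /prabhakar_term /prabhakar_bound/= !normrM normrX normrN (ger0_norm q0).
rewrite (ger0_norm (ler0n _ _)) (ger0_norm (powR_ge0 _ _)) normfV (gtr0_norm G0).
have h1 : 'C(k + j, j)%:R <= 2 ^+ k * 2 ^+ j :> R.
  by rewrite -exprD -natrX ler_nat bin_le_exp2.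
have h2 := powR_div_Gamma_le b00 bj c1 t0.
apply: (le_trans (ler_pM _ _ (ler_wpM2r _ h1) h2)); rewrite ?mulr_ge0 ?exprn_ge0 ?powR_ge0 ?invr_ge0 ?(ltW G0)//.
have -> : c `^ (- (j%:R * a + b - b0)) = c `^ (- (b - b0)) * (c `^ (- a)) ^+ j.
  rewrite -powR_mulrn ?powR_ge0// -powRrM -powRD ?(gt_eqF c0) ?implybT//.
  by congr powR; ring.
have h3 : (2 * (q * c `^ (- a))) ^+ j <= 2^-1 ^+ j.
  by rewrite lerXn2r// ?nnegrE ?mulr_ge0 ?powR_ge0//; lra.
rewrite !exprMn in h3.
set X := c `^ (- a) in h3 *; set Y := c `^ (- (b - b0)); set Z := t `^ (b0 - 1).
set W := expR (2 * c * t); set V := expR 3.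
have -> : 2 ^+ k * 2 ^+ j * q ^+ j * (Y * X ^+ j * (2 * V * Z * W)) =
  2 ^+ k * Y * (2 * V) * (2 ^+ j * (q ^+ j * X ^+ j)) * (Z * W) by ring.
rewrite ler_wpM2r ?mulr_ge0 ?powR_ge0 ?expR_ge0// ler_wpM2l//.
by rewrite !mulr_ge0 ?powR_ge0 ?expR_ge0 ?exprn_ge0.
Qed.

Lemma prabhakar_bound_ge0 {R : realType} (b0 b c : R) (k j : nat) :
  0 <= prabhakar_bound b0 b c k j.
Proof.
by rewrite /prabhakar_bound/= !mulr_ge0 ?exprn_ge0 ?powR_ge0 ?expR_ge0 ?invr_ge0.
Qed.

Lemma cvg_prabhakar_bound {R : realType} (b0 b c : R) (k : nat) :
  series (prabhakar_bound b0 b c k) @ \oo -->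
  2 ^+ k * c `^ (- (b - b0)) * (4 * expR 3).
Proof.
have -> : 2 ^+ k * c `^ (- (b - b0)) * (4 * expR 3) =
   2 ^+ k * c `^ (- (b - b0)) * (2 * expR 3) / (1 - 2^-1) by field.
by apply: cvg_geometric_series; rewrite ger0_norm// invf_lt1// ltr1n.
Qed.

(** Moving t^(b-1) under [limn] requires convergence of the Mittag-Leffler series itself; this comes
    from the dominated series of terms, divided by the nonzero factor t^(b-1). *)
Lemma prabhakar_series {R : realType} (a b0 b c q : R) (k : nat) (t : R) :
  0 < a -> 0 < b0 -> b0 <= b -> 0 <= q -> 1 <= c -> q * c `^ (- a) <= 1 / 4 ->
  0 < t -> prabhakar a b q k t = limn (series (fun j => prabhakar_term a b q k j t)).
Proof.
move=> a0 b00 bb q0 c1 qc t0.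
have g0 : 0 <= t `^ (b0 - 1) * expR (2 * c * t) by rewrite mulr_ge0 ?powR_ge0 ?expR_ge0.
have [cs _] := dominated_series g0 (@prabhakar_bound_ge0 R b0 b c k)
  (fun j => prabhakar_term_bound k j a0 b00 bb q0 c1 qc t0) (cvgP _ (@cvg_prabhakar_bound R b0 b c k)).
have tb0 : t `^ (b - 1) != 0 by rewrite gt_eqF// powR_gt0.
rewrite /prabhakar /mittag_leffler; set v := (fun j : nat => _ / _).
have E : (fun j => prabhakar_term a b q k j t) = t `^ (b - 1) *: v.
  apply/funext => j; rewrite /v /prabhakar_term -[RHS]/(t `^ (b - 1) * _).
  rewrite invfM mulrA -rising_factorialE exprNn [in RHS]exprNn exprMn.
  have -> : t `^ (j%:R * a + b - 1) = t `^ (b - 1) * (t `^ a) ^+ j.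
    rewrite -powR_mulrn ?powR_ge0// -powRrM -powRD ?(gt_eqF t0) ?implybT//.
    by congr powR; ring.
  ring.
rewrite E lim_seriesZ//.
have -> : v = (t `^ (b - 1))^-1 *: (fun j => prabhakar_term a b q k j t).
  by rewrite E scalerA mulVf// scale1r.
exact: is_cvg_seriesZ.
Qed.

Lemma laplace_prabhakar_term {R : realType} (a b q s : R) (k j : nat) :
  0 < a -> 0 < b -> 0 < s ->
  laplace (prabhakar_term a b q k j) s =
  s `^ (- b) * ('C(k + j, j)%:R * (- (q * s `^ (- a))) ^+ j).
Proof.
move=> a0 b0 s0; have jb0 : 0 < j%:R * a + b by rewrite ltr_wpDl// mulr_ge0// ltW.
have G0 := lt0r_neq0 (Gamma_gt0 jb0).
transitivity (\int[mu]_(t in `]0, +oo[) ('C(k + j, j)%:R * (- q) ^+ j / Gamma_function (j%:R * a + b) *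
   (t `^ (j%:R * a + b - 1) * expR (- (s * t))))).
  by apply: eq_Rintegral => t _; rewrite /prabhakar_term; ring.
rewrite RintegralZl//; last exact: integrable_powR_expRN.
rewrite Gamma_scale//.
have -> : s `^ (- (j%:R * a + b)) = s `^ (- b) * (s `^ (- a)) ^+ j.
  rewrite -powR_mulrn ?powR_ge0// -powRrM -powRD ?(gt_eqF s0) ?implybT//.
  by congr powR; ring.
by rewrite exprNn [in RHS]exprNn exprMn; field.
Qed.

Lemma continuous_powR_gt0 {R : realType} (p t : R) : 0 < t ->
  {for t, continuous (fun t : R => t `^ p)}.
Proof.
move=> t0; apply: differentiable_continuous; apply/derivable1_diffP.
by apply: derivable_powR; rewrite in_itv/= andbT.
Qed.

Lemma continuous_prabhakar_term {R : realType} (a b q : R) (k j : nat) (t : R) :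
  0 < t -> {for t, continuous (prabhakar_term a b q k j)}.
Proof.
move=> t0; rewrite /prabhakar_term.
apply: continuousM; first exact: cst_continuous.
by apply: continuousM; [exact: continuous_powR_gt0|exact: cst_continuous].
Qed.

Lemma prabhakar_le {R : realType} (a b0 b c q : R) (k : nat) (t : R) :
  0 < a -> 0 < b0 -> b0 <= b -> 0 <= q -> 1 <= c -> q * c `^ (- a) <= 1 / 4 ->
  0 < t -> `|prabhakar a b q k t| <=
  2 ^+ k * c `^ (- (b - b0)) * (4 * expR 3) * (t `^ (b0 - 1) * expR (2 * c * t)).
Proof.
move=> a0 b00 bb q0 c1 qc t0.
have g0 : 0 <= t `^ (b0 - 1) * expR (2 * c * t) by rewrite mulr_ge0 ?powR_ge0 ?expR_ge0.
have [cs] := dominated_series g0 (@prabhakar_bound_ge0 R b0 b c k)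
  (fun j => prabhakar_term_bound k j a0 b00 bb q0 c1 qc t0) (cvgP _ (@cvg_prabhakar_bound R b0 b c k)).
(* The remainder after zero terms is the whole sum. *)
move=> /(_ 0%N); rewrite (cvg_lim _ (@cvg_prabhakar_bound R b0 b c k))//.
by rewrite {2 3}/series/= !big_geq// !subr0 -(prabhakar_series _ a0 b00 bb q0 c1 qc t0).
Qed.

Lemma continuous_prabhakar {R : realType} (a b0 b c q : R) (k : nat) :
  0 < a -> 0 < b0 -> b0 <= b -> 0 <= q -> 1 <= c -> q * c `^ (- a) <= 1 / 4 ->
  forall t, 0 < t -> {for t, continuous (prabhakar a b q k)}.
Proof.
move=> a0 b00 bb q0 c1 qc t t0.
have [+ _] := tame_series (@prabhakar_bound_ge0 R b0 b c k) (cvgP _ (@cvg_prabhakar_bound R b0 b c k))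
  (fun j t t0 => @continuous_prabhakar_term R a b q k j t t0)
  (fun j t t0 => prabhakar_term_bound k j a0 b00 bb q0 c1 qc t0).
move=> /(_ t t0); rewrite /prop_for /continuous_at => h.
rewrite (prabhakar_series _ a0 b00 bb q0 c1 qc t0).
apply: cvg_trans h; apply: near_eq_cvg; near=> x.
by rewrite (prabhakar_series _ a0 b00 bb q0 c1 qc)//; near: x; exact: lt_nbhsr.
Unshelve. all: by end_near. Qed.

(** The condition s > 2c serves twice: it makes the dominating functions integrable, and it gives s
    >= c, hence q s^(-a) <= 1/4, where the negative binomial series applies. *)
Lemma laplace_prabhakar {R : realType} (a b0 b c q s : R) (k : nat) :
  0 < a -> 0 < b0 -> b0 <= b -> 0 <= q -> 1 <= c -> q * c `^ (- a) <= 1 / 4 ->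
  2 * c < s ->
  laplace (prabhakar a b q k) s = s `^ (- b) * (1 + q * s `^ (- a)) ^- k.+1.
Proof.
move=> a0 b00 bb q0 c1 qc cs.
have c0 : 0 < c by exact: lt_le_trans c1.
have s0 : 0 < s by rewrite (lt_trans _ cs)// mulr_gt0.
have bp : 0 < b by exact: lt_le_trans bb.
have h := laplace_series b00 cs (@prabhakar_bound_ge0 R b0 b c k) (cvgP _ (@cvg_prabhakar_bound R b0 b c k))
  (fun j t t0 => @continuous_prabhakar_term R a b q k j t t0)
  (fun j t t0 => prabhakar_term_bound k j a0 b00 bb q0 c1 qc t0).
have -> : laplace (prabhakar a b q k) s =
    laplace (fun t => limn (series (fun j => prabhakar_term a b q k j t))) s.
  apply: eq_Rintegral => t; rewrite inE/= in_itv/= andbT => t0.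
  by rewrite (prabhakar_series _ a0 b00 bb q0 c1 qc).
apply: (cvg_unique _ h) => //.
have -> : (fun j => laplace (prabhakar_term a b q k j) s) =
    s `^ (- b) *: (fun j => 'C(k + j, j)%:R * (- (q * s `^ (- a))) ^+ j).
  by apply/funext => j; rewrite laplace_prabhakar_term.
have y4 : `|- (q * s `^ (- a))| <= 1 / 4.
  rewrite normrN ger0_norm ?mulr_ge0 ?powR_ge0//; apply: le_trans qc.
  rewrite ler_wpM2l// !powRN lef_pV2 ?posrE ?powR_gt0//.
  by apply: ge0_ler_powR; rewrite ?nnegrE; lra.
have := @cvg_negative_binomial R k _ y4; rewrite opprK => hb.
rewrite seriesZ; apply: cvgM => //; exact: cvg_cst.
Qed.

(** * The double series common to f and g *)

(** On ]0, +oo[ both [mfpp_f] and [mfpp_g] have this form, with p = C2 / C1, q = lambda / C1 and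
    their own [b]; the powers of t^(a1-a2) are absorbed in the exponents of the Prabhakar
    kernels. *)
Definition mfpp_kernel {R : realType} (a1 a2 b p q t : R) : R :=
  limn (series (fun k : nat => (- p) ^+ k * prabhakar a1 (b + (a1 - a2) * k%:R) q k t)).

Lemma exists_large_base {R : realType} (a q : R) : 0 < a -> 0 <= q ->
  exists c0, forall c, 1 <= c -> c0 <= c -> q * c `^ (- a) <= 1 / 4.
Proof.
move=> a0 q0; exists ((4 * q) `^ a^-1) => c c1 cc.
have c0 : 0 < c by exact: lt_le_trans c1.
have h : 4 * q <= c `^ a.
  have -> : 4 * q = ((4 * q) `^ a^-1) `^ a.
    by rewrite -powRrM mulVf ?gt_eqF// powRr1// mulr_ge0.
  by apply: ge0_ler_powR; rewrite ?nnegrE ?powR_ge0 ?(ltW a0) ?(ltW c0).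
by rewrite powRN ler_pdivrMr ?powR_gt0//; move: h; lra.
Qed.

Section kernel.
Context {R : realType} (a1 a2 b p q c : R).
Hypotheses (a20 : 0 < a2) (a12 : a2 < a1) (b0 : 0 < b) (p0 : 0 <= p) (q0 : 0 <= q).
Hypotheses (c1 : 1 <= c) (qc : q * c `^ (- a1) <= 1 / 4)
  (pc : p * c `^ (- (a1 - a2)) <= 1 / 4).

Let a10 : 0 < a1. Proof. exact: lt_trans a12. Qed.
Let c0 : 0 < c. Proof. exact: lt_le_trans c1. Qed.

Let u k t := (- p) ^+ k * prabhakar a1 (b + (a1 - a2) * k%:R) q k t.
Let m : R^nat := geometric (4 * expR 3) 2^-1.

Let bk k : b <= b + (a1 - a2) * k%:R.
Proof. by rewrite lerDl mulr_ge0// subr_ge0 ltW. Qed.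

Let m0 k : 0 <= m k.
Proof. by rewrite /m/= !mulr_ge0 ?exprn_ge0 ?expR_ge0 ?invr_ge0. Qed.

Let cm : cvgn (series m).
Proof. by apply: is_cvg_geometric_series; rewrite ger0_norm// invf_lt1// ltr1n. Qed.

Let cu k t : 0 < t -> {for t, continuous (u k)}.
Proof.
move=> t0; rewrite /u; apply: continuousM; first exact: cst_continuous.
by have := @continuous_prabhakar R _ _ _ _ _ k a10 b0 (bk k) q0 c1 qc; apply.
Qed.

(** The k-th Prabhakar kernel costs 2^k but gains c^(-(a1-a2)k); with p c^(-(a1-a2)) <= 1/4 the
    outer series is again geometric with ratio 1/2. *)
Let um k t : 0 < t -> `|u k t| <= m k * (t `^ (b - 1) * expR (2 * c * t)).
Proof.
move=> t0; rewrite /u normrM normrX normrN (ger0_norm p0).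
have h := prabhakar_le k a10 b0 (bk k) q0 c1 qc t0.
apply: (le_trans (ler_wpM2l _ h)); first by rewrite exprn_ge0.
have : 0 <= t `^ (b - 1) * expR (2 * c * t) by rewrite mulr_ge0 ?powR_ge0 ?expR_ge0.
set G := t `^ (b - 1) * _ => G0; rewrite [leLHS]mulrA ler_wpM2r//.
have -> : c `^ (- (b + (a1 - a2) * k%:R - b)) = (c `^ (- (a1 - a2))) ^+ k.
  by rewrite -powR_mulrn ?powR_ge0// -powRrM; congr powR; ring.
have := pc; set X := c `^ _ => pX.
have h3 : (2 * (p * X)) ^+ k <= 2^-1 ^+ k.
  by rewrite lerXn2r// ?nnegrE ?mulr_ge0 ?powR_ge0//; move: pX; lra.
rewrite !exprMn in h3; rewrite /m/=.
have -> : p ^+ k * (2 ^+ k * X ^+ k * (4 * expR 3)) =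
  4 * expR 3 * (2 ^+ k * (p ^+ k * X ^+ k)) by ring.
by rewrite ler_wpM2l// mulr_ge0 ?expR_ge0.
Qed.

Lemma tame_mfpp_kernel : tame b (2 * c) (mfpp_kernel a1 a2 b p q).
Proof. exact: tame_series m0 cm cu um. Qed.

Lemma laplace_mfpp_kernel (s : R) : 2 * c < s ->
  laplace (mfpp_kernel a1 a2 b p q) s =
  s `^ (- b) / (1 + q * s `^ (- a1) + p * s `^ (- (a1 - a2))).
Proof.
move=> cs; have s0 : 0 < s by rewrite (lt_trans _ cs)// mulr_gt0.
have h := laplace_series b0 cs m0 cm cu um.
apply: (cvg_unique _ h) => //.
set Q := q * _; set P := p * _.
have Q0 : 0 <= Q by rewrite mulr_ge0 ?powR_ge0.
have P0 : 0 <= P by rewrite mulr_ge0 ?powR_ge0.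
have P4 : P <= 1 / 4.
  apply: le_trans pc; rewrite ler_wpM2l// (powRN s) (powRN c) lef_pV2 ?posrE ?powR_gt0//.
  apply: ge0_ler_powR; rewrite ?nnegrE ?subr_ge0 ?(ltW a12) ?(ltW c0) ?(ltW s0)//.
  by rewrite (le_trans _ (ltW cs))// ler_peMl ?(ltW c0)// ler1n.
have Q1 : 1 + Q != 0 by rewrite gt_eqF// ltr_wpDr.
(* The exponent shift (a1 - a2) k and the power k + 1 in the transform of the k-th kernel combine
   into a geometric sequence whose ratio has modulus at most P <= 1/4. *)
have -> : (fun k => laplace (u k) s) = geometric (s `^ (- b) / (1 + Q)) (- P / (1 + Q)).
  apply/funext => k; rewrite /u/=.
  transitivity ((- p) ^+ k * laplace (prabhakar a1 (b + (a1 - a2) * k%:R) q k) s).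
    rewrite /laplace -RintegralZl//.
      by apply: eq_Rintegral => t _; rewrite mulrA.
    apply: (@tame_laplace_integrable _ b (2 * c)) => //; split.
      exact: (@continuous_prabhakar R _ _ _ _ _ k a10 b0 (bk k) q0 c1 qc).
    eexists; last exact: (fun t => prabhakar_le k a10 b0 (bk k) q0 c1 qc).
    by rewrite !mulr_ge0 ?exprn_ge0 ?powR_ge0 ?expR_ge0.
  rewrite (laplace_prabhakar k a10 b0 (bk k) q0 c1 qc cs) -/Q.
  have -> : s `^ (- (b + (a1 - a2) * k%:R)) = s `^ (- b) * (s `^ (- (a1 - a2))) ^+ k.
    rewrite -powR_mulrn ?powR_ge0// -powRrM -powRD ?(gt_eqF s0) ?implybT//.
    by congr powR; ring.
  rewrite exprSr /P; set X := s `^ (- (a1 - a2)).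
  rewrite expr_div_n (exprNn (p * X)) (exprNn p) exprMn.
  by field; rewrite Q1 expf_neq0.
have -> : s `^ (- b) / (1 + Q + P) = s `^ (- b) / (1 + Q) / (1 - - P / (1 + Q)).
  by field; rewrite Q1 opprK gt_eqF// -addrA ltr_wpDr// addr_ge0.
apply: cvg_geometric_series.
rewrite normrM normrN (ger0_norm P0) ger0_norm; last by rewrite invr_ge0 addr_ge0.
by rewrite ltr_pdivrMr ?ltr_wpDr// mul1r (le_lt_trans P4)// (lt_le_trans _ (_ : 1 <= _))//; lra.
Qed.

(** Extracting t^(b-1) from [limn] again needs convergence of the reduced series, inherited from the
    dominated one. *)
Lemma mfpp_kernel_factor (v : R^nat) (t : R) : 0 < t ->
  (forall k, u k t = t `^ (b - 1) * v k) ->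
  mfpp_kernel a1 a2 b p q t = t `^ (b - 1) * limn (series v).
Proof.
move=> t0 uv.
have g0 : 0 <= t `^ (b - 1) * expR (2 * c * t) by rewrite mulr_ge0 ?powR_ge0 ?expR_ge0.
have [cs _] := dominated_series g0 m0 (fun k => um k t0) cm.
have tb0 : t `^ (b - 1) != 0 by rewrite gt_eqF// powR_gt0.
have E : u^~ t = t `^ (b - 1) *: v by apply/funext => k; exact: uv.
have Ev : v = (t `^ (b - 1))^-1 *: u^~ t by rewrite E scalerA mulVf// scale1r.
rewrite /mfpp_kernel -/(u^~ t) E lim_seriesZ// Ev.
exact: is_cvg_seriesZ.
Qed.

End kernel.

(** Serves to pass from the kernel to [mfpp_f] and [mfpp_g], which are identified with it at
    positive times. *)
Lemma eq_tame {R : realType} (b c : R) (f g : R -> R) :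
  (forall t, 0 < t -> f t = g t) -> tame b c g -> tame b c f.
Proof.
move=> fg [cg [M M0 gM]]; split=> [t t0|]; last first.
  by exists M => // t t0; rewrite fg//; exact: gM.
have := cg t t0; rewrite /prop_for /continuous_at fg//; apply: cvg_trans.
by apply: near_eq_cvg; near=> x; rewrite fg//; near: x; exact: lt_nbhsr.
Unshelve. all: by end_near. Qed.

Lemma eq_laplace {R : realType} (f g : R -> R) (s : R) :
  (forall t, 0 < t -> f t = g t) -> laplace f s = laplace g s.
Proof.
by move=> fg; apply: eq_Rintegral => t; rewrite inE/= in_itv/= andbT => t0; rewrite fg.
Qed.

Lemma convolution_power_tame {R : realType} (b c : R) (h : R -> R) (n : nat) :
  0 < b -> tame b c h ->
  tame (n.+1%:R * b) c (convolution_power h n.+1) /\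
  forall s, c < s -> laplace (convolution_power h n.+1) s = laplace h s ^+ n.+1.
Proof.
move=> b0 th; rewrite /convolution_power/=.
elim: n => [|n [tn ln]]; first by rewrite mul1r; split=> // s cs; rewrite expr1.
have nb : 0 < n.+1%:R * b by rewrite mulr_gt0.
split=> [|s cs]; rewrite iterS.
  have -> : n.+2%:R * b = b + n.+1%:R * b by rewrite -(natr1 n.+1); ring.
  exact: tame_convolution.
by rewrite (laplace_convolution b0 nb cs th tn) ln// -exprS.
Qed.

Lemma mfpp_prabhakar_coef {R : realType} (a1 a2 b p q t : R) (k : nat) : 0 < t ->
  (- p) ^+ k * prabhakar a1 (b + (a1 - a2) * k%:R) q k t =
  t `^ (b - 1) * ((- (p * t `^ (a1 - a2))) ^+ k *
    mittag_leffler a1 ((a1 - a2) * k%:R + b) k.+1%:R (- (q * t `^ a1))).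
Proof.
move=> t0; rewrite /prabhakar (addrC ((a1 - a2) * _)).
have -> : t `^ (b + (a1 - a2) * k%:R - 1) = t `^ (b - 1) * (t `^ (a1 - a2)) ^+ k.
  rewrite -powR_mulrn ?powR_ge0// -powRrM -powRD ?(gt_eqF t0) ?implybT//.
  by congr powR; ring.
by rewrite exprNn (exprNn (p * _)) exprMn; ring.
Qed.


(** * Transform of the right-hand side *)

Section mfpp_transforms.
Context {R : realType} (a1 a2 lambda C1 C2 : R) (n : nat).
Hypotheses (a20 : 0 < a2) (a12 : a2 < a1) (l0 : 0 < lambda)
  (C10 : 0 < C1) (C20 : 0 <= C2).

Let p0 : 0 <= C2 / C1. Proof. by rewrite divr_ge0// ltW. Qed.
Let q0 : 0 <= lambda / C1. Proof. by rewrite divr_ge0// ltW. Qed.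
Let a10 : 0 < a1. Proof. exact: lt_trans a12. Qed.
Let n0 : n.+1%:R != 0 :> R. Proof. by rewrite pnatr_eq0. Qed.

Let large_base : exists c : R, [/\ 1 <= c, lambda / C1 * c `^ (- a1) <= 1 / 4 &
  C2 / C1 * c `^ (- (a1 - a2)) <= 1 / 4].
Proof.
have [c1 h1] := exists_large_base a10 q0.
have d0 : 0 < a1 - a2 by rewrite subr_gt0.
have [c2 h2] := exists_large_base d0 p0.
exists (Num.max 1 (Num.max c1 c2)); split; first by rewrite le_max lexx.
- by apply: h1; rewrite !le_max lexx// orbT.
- by apply: h2; rewrite !le_max lexx ?orbT.
Qed.

Lemma mfpp_f_kernel (c t : R) : 1 <= c -> lambda / C1 * c `^ (- a1) <= 1 / 4 ->
  C2 / C1 * c `^ (- (a1 - a2)) <= 1 / 4 -> 0 < t ->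
  mfpp_f a1 a2 lambda C1 C2 n t =
  mfpp_kernel a1 a2 ((n%:R * a1 + 1) / n.+1%:R) (C2 / C1) (lambda / C1) t.
Proof.
move=> c1 qc pc t0.
set b := (n%:R * a1 + 1) / n.+1%:R.
have b0 : 0 < b by rewrite divr_gt0// ltr_wpDl// mulr_ge0// ltW.
rewrite (mfpp_kernel_factor a20 a12 b0 p0 q0 c1 qc pc t0
  (fun k => mfpp_prabhakar_coef a1 a2 b _ _ k t0)).
rewrite /mfpp_f; congr (_ * _).
  (* The power in front of the series is t^(b-1): (n a1 + 1) / (n + 1) - 1 = n (a1 - 1) / (n +
     1). *)
  by congr powR; rewrite /b -natr1; field; rewrite natr1 n0.
by congr (limn (series _)); apply/funext => k; rewrite (mulrAC C2) (mulrAC lambda).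
Qed.

Lemma mfpp_g_kernel (c t : R) : 1 <= c -> lambda / C1 * c `^ (- a1) <= 1 / 4 ->
  C2 / C1 * c `^ (- (a1 - a2)) <= 1 / 4 -> 0 < t ->
  mfpp_g a1 a2 lambda C1 C2 n t =
  mfpp_kernel a1 a2 ((n%:R * a1 + a1 - a2 + 1) / n.+1%:R) (C2 / C1) (lambda / C1) t.
Proof.
move=> c1 qc pc t0.
set b := (_ + 1) / n.+1%:R.
have b0 : 0 < b.
  by rewrite divr_gt0// ltr_wpDl// -addrA addr_ge0// ?subr_ge0 ?mulr_ge0// ltW.
rewrite (mfpp_kernel_factor a20 a12 b0 p0 q0 c1 qc pc t0
  (fun k => mfpp_prabhakar_coef a1 a2 b _ _ k t0)).
rewrite /mfpp_g; congr (_ * _).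
  by congr powR; rewrite /b -natr1; field; rewrite natr1 n0.
by congr (limn (series _)); apply/funext => k; rewrite (mulrAC C2) (mulrAC lambda).
Qed.

Let rhs t := lambda ^+ n / C1 ^+ n.+1 *
   (C1 * convolution_power (mfpp_f a1 a2 lambda C1 C2 n) n.+1 t +
    C2 * convolution_power (mfpp_g a1 a2 lambda C1 C2 n) n.+1 t).

(** Numerator and denominator are multiplied by C1 s^a1, which turns the denominator into the one in
    the statement and shifts the exponent -b to a1 - b. *)
Let laplace_power (b s : R) : 0 < s ->
  (s `^ (- b) / (1 + lambda / C1 * s `^ (- a1) + C2 / C1 * s `^ (- (a1 - a2)))) ^+ n.+1 =
  C1 ^+ n.+1 * s `^ (n.+1%:R * (a1 - b)) /
  (lambda + C1 * s `^ a1 + C2 * s `^ a2) ^+ n.+1.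
Proof.
move=> s0; have sa (x : R) : s `^ x != 0 by rewrite gt_eqF// powR_gt0.
have -> : s `^ (n.+1%:R * (a1 - b)) = (s `^ a1 * s `^ (- b)) ^+ n.+1.
  rewrite -powRD ?(gt_eqF s0) ?implybT// -powR_mulrn ?powR_ge0// -powRrM.
  by rewrite mulrC.
rewrite -exprMn -expr_div_n; congr (_ ^+ _).
have -> : s `^ (- (a1 - a2)) = s `^ a2 / s `^ a1.
  by rewrite -powRN -powRD ?(gt_eqF s0) ?implybT//; congr powR; ring.
rewrite (powRN s a1); set A := s `^ a1; set B := s `^ a2; set E := s `^ (- b).
have A0 : A != 0 by exact: sa.
have Ap : 0 < A by exact: powR_gt0.
have Bp : 0 < B by exact: powR_gt0.
field; rewrite A0 (gt_eqF C10)/=.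
have D0 : 0 < lambda + C1 * A + C2 * B.
  by rewrite ltr_wpDr ?mulr_ge0 ?(ltW Bp)// addr_gt0// mulr_gt0.
by rewrite gt_eqF.
Qed.

Lemma laplace_mfpp_rhs : exists2 s0, 0 < s0 & 
  (forall t, 0 < t -> {for t, continuous rhs}) /\
  forall s, s0 < s -> laplace_integrable rhs s /\
  laplace rhs s = lambda ^+ n * (C1 * s `^ (a1 - 1) + C2 * s `^ (a2 - 1)) /
    (lambda + C1 * s `^ a1 + C2 * s `^ a2) ^+ n.+1.
Proof.
have [c [c1 qc pc]] := large_base.
have c0 : 0 < c by exact: lt_le_trans c1.
exists (2 * c); first by rewrite mulr_gt0.
set bf := (n%:R * a1 + 1) / n.+1%:R.
set bg := (n%:R * a1 + a1 - a2 + 1) / n.+1%:R.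
have bf0 : 0 < bf by rewrite divr_gt0// ltr_wpDl// mulr_ge0// ltW.
have bg0 : 0 < bg.
  by rewrite divr_gt0// ltr_wpDl// -addrA addr_ge0// ?subr_ge0 ?mulr_ge0// ltW.
have ef t := @mfpp_f_kernel c t c1 qc pc.
have eg t := @mfpp_g_kernel c t c1 qc pc.
have tf := eq_tame ef (tame_mfpp_kernel a20 a12 bf0 p0 q0 c1 qc pc).
have tg := eq_tame eg (tame_mfpp_kernel a20 a12 bg0 p0 q0 c1 qc pc).
have [tF lF] := convolution_power_tame n bf0 tf.
have [tG lG] := convolution_power_tame n bg0 tg.
split=> [t t0|s cs].
  apply: continuousM; first exact: cst_continuous.
  apply: continuousD; apply: continuousM; try exact: cst_continuous.
    exact: tF.1.
  exact: tG.1.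
have s0 : 0 < s by rewrite (lt_trans _ cs)// mulr_gt0.
have nb (b : R) : 0 < b -> 0 < n.+1%:R * b by move=> ?; rewrite mulr_gt0.
have iF := tame_laplace_integrable (nb _ bf0) cs tF.
have iG := tame_laplace_integrable (nb _ bg0) cs tG.
have lf := lF s cs; have lg := lG s cs.
rewrite (eq_laplace s ef) (laplace_mfpp_kernel a20 a12 bf0 p0 q0 c1 qc pc cs) in lf.
rewrite (eq_laplace s eg) (laplace_mfpp_kernel a20 a12 bg0 p0 q0 c1 qc pc cs) in lg.
rewrite laplace_power// in lf; rewrite laplace_power// in lg.
(* What remains depends on the two convolution powers through their transforms only, so they are
   replaced by arbitrary functions. *)
suff aux (F G : R -> R) : laplace_integrable F s -> laplace_integrable G s ->
    laplace F s = C1 ^+ n.+1 * s `^ (n.+1%:R * (a1 - bf)) /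
      (lambda + C1 * s `^ a1 + C2 * s `^ a2) ^+ n.+1 ->
    laplace G s = C1 ^+ n.+1 * s `^ (n.+1%:R * (a1 - bg)) /
      (lambda + C1 * s `^ a1 + C2 * s `^ a2) ^+ n.+1 ->
    laplace_integrable (fun t => lambda ^+ n / C1 ^+ n.+1 * (C1 * F t + C2 * G t)) s /\
    laplace (fun t => lambda ^+ n / C1 ^+ n.+1 * (C1 * F t + C2 * G t)) s =
      lambda ^+ n * (C1 * s `^ (a1 - 1) + C2 * s `^ (a2 - 1)) /
      (lambda + C1 * s `^ a1 + C2 * s `^ a2) ^+ n.+1 by exact: aux iF iG lf lg.
move=> {}iF {}iG {}lf {}lg.
have -> : (fun t => lambda ^+ n / C1 ^+ n.+1 * (C1 * F t + C2 * G t)) = fun t =>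
    lambda ^+ n / C1 ^+ n.+1 * C1 * F t + lambda ^+ n / C1 ^+ n.+1 * C2 * G t.
  by apply/funext => t; rewrite mulrDr !mulrA.
have [iFG ->] := laplace_linear (lambda ^+ n / C1 ^+ n.+1 * C1)
  (lambda ^+ n / C1 ^+ n.+1 * C2) iF iG.
split=> //; rewrite lf lg.
have -> : n.+1%:R * (a1 - bf) = a1 - 1 by rewrite /bf -natr1; field; rewrite natr1 n0.
have -> : n.+1%:R * (a1 - bg) = a2 - 1 by rewrite /bg -natr1; field; rewrite natr1 n0.
have Bp : 0 < s `^ a2 by exact: powR_gt0.
have Ap : 0 < s `^ a1 by exact: powR_gt0.
have D0 : 0 < lambda + C1 * s `^ a1 + C2 * s `^ a2.
  by rewrite ltr_wpDr ?mulr_ge0 ?(ltW Bp)// addr_gt0// mulr_gt0.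
field.
by rewrite !expf_neq0 ?(gt_eqF C10) ?(gt_eqF D0).
Qed.

End mfpp_transforms.

(** * Uniqueness of the Laplace transform *)

(** The map 4x(1 - x) at x = e^(-sg t): it rises to 1 at x = 1/2 and falls again, so its powers
    concentrate at one time, while its m-th power is a combination of exponentials of rates at least
    sg m. *)
Definition laplace_bump {R : realType} (sg t : R) : R :=
  4 * expR (- (sg * t)) * (1 - expR (- (sg * t))).

(** Multiplication by 1 - e^(-sg t) replaces the transform at s by its difference between s and s +
    sg, so vanishing beyond [s0] is preserved. The other factor, e^(-sg m t), is evaluation of the
    transform at sg m > s0. *)
Lemma laplace0_bump {R : realType} (F : R -> R) (s0 sg : R) (m : nat) : 0 < sg ->
  (forall s, s0 < s -> laplace_integrable F s /\ laplace F s = 0) ->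
  s0 < sg * m%:R ->
  mu.-integrable `]0, +oo[ (fun t => (F t * laplace_bump sg t ^+ m)%:E) /\
  \int[mu]_(t in `]0, +oo[) (F t * laplace_bump sg t ^+ m) = 0.
Proof.
move=> sg0 F0 sm.
pose x (t : R) := 1 - expR (- (sg * t)).
have h k : forall s, s0 < s ->
    laplace_integrable (fun t => F t * x t ^+ k) s /\ laplace (fun t => F t * x t ^+ k) s = 0.
  elim: k => [|k IH] s s0s.
    rewrite (_ : (fun t => F t * x t ^+ 0) = F); first exact: F0.
    by apply/funext => t; rewrite expr0 mulr1.
  have [i1 l1] := IH _ s0s.
  have [i2 l2] := IH (s + sg) (lt_trans s0s (ltr_pwDr sg0 (lexx s))).
  have E t : F t * x t ^+ k.+1 * expR (- (s * t)) =
      F t * x t ^+ k * expR (- (s * t)) - F t * x t ^+ k * expR (- ((s + sg) * t)).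
    by rewrite mulrDl opprD expRD exprSr {2}/x; ring.
  split.
    rewrite /laplace_integrable.
    have -> : (fun t => (F t * x t ^+ k.+1 * expR (- (s * t)))%:E) =
      ((fun t => (F t * x t ^+ k * expR (- (s * t)))%:E) \-
       (fun t => (F t * x t ^+ k * expR (- ((s + sg) * t)))%:E))%E.
      by apply/funext => t; rewrite E.
    exact: integrableB.
  rewrite /laplace; under eq_Rintegral do rewrite E.
  by rewrite RintegralB//; move: l1 l2; rewrite /laplace => -> ->; rewrite subrr.
have [i1 l1] := h m _ sm.
have E t : F t * laplace_bump sg t ^+ m = 4 ^+ m * (F t * x t ^+ m * expR (- (sg * m%:R * t))).
  rewrite /laplace_bump -/(x t) !exprMn.
  have -> : expR (- (sg * m%:R * t)) = expR (- (sg * t)) ^+ m.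
    by rewrite -expRM_natr; congr expR; ring.
  ring.
split.
  have : mu.-integrable `]0, +oo[ (fun t => (4 ^+ m)%:E * (F t * x t ^+ m * expR (- (sg * m%:R * t)))%:E)%E.
    by apply: integrableZl => //; exact: i1.
  by apply: eq_integrable => // t _; rewrite E.
under eq_Rintegral do rewrite E.
by rewrite RintegralZl//; move: l1; rewrite /laplace => ->; rewrite mulr0.
Qed.

Lemma laplace_bump_bounds {R : realType} (sg t : R) : 0 < sg -> 0 < t ->
  0 <= laplace_bump sg t <= 1.
Proof.
move=> sg0 t0; rewrite /laplace_bump.
have : expR (- (sg * t)) <= 1 by rewrite expR_le1 oppr_le0 mulr_ge0 ?ltW.
have := expR_ge0 (- (sg * t)).
set x := expR _ => x0 x1; apply/andP; split; first by rewrite !mulr_ge0 ?subr_ge0.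
have := sqr_ge0 (1 - 2 * x); nra.
Qed.

Lemma laplace_bumpE {R : realType} (sg t : R) :
  laplace_bump sg t = 1 - (1 - 2 * expR (- (sg * t))) ^+ 2.
Proof. by rewrite /laplace_bump; ring. Qed.

(* The maximum of [laplace_bump sg] is at [t = ln 2 / sg], hence the choice of [sg]. *)
Lemma laplace_bump_peak {R : realType} (a b c : R) : 0 < a -> a < b -> b < c ->
  exists sg, [/\ 0 < sg, laplace_bump sg b = 1 &
    exists rho, [/\ 0 <= rho, rho < 1 & forall t, 0 < t -> t <= a \/ c <= t ->
      laplace_bump sg t <= rho]].
Proof.
move=> a0 ab bc; have b0 : 0 < b by exact: lt_trans ab.
have ln20 : 0 < ln (2 : R) by rewrite ln_gt0// ltr1n.
pose sg := ln 2 / b; have sg0 : 0 < sg by rewrite divr_gt0.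
have xb : expR (- (sg * b)) = 2^-1.
  by rewrite /sg divfK ?gt_eqF// expRN lnK// posrE.
exists sg; split=> //.
  by rewrite laplace_bumpE xb mulfV// subrr expr0n subr0.
have mono u v : u < v -> expR (- (sg * v)) < expR (- (sg * u)).
  by move=> uv; rewrite ltr_expR ltrN2 ltr_pM2l.
have xa : 2^-1 < expR (- (sg * a)) by rewrite -xb mono.
have xc : expR (- (sg * c)) < 2^-1 by rewrite -xb mono.
(* The bump is 1 - (1 - 2x)^2 with x decreasing in t; [eta] is the smaller of the values of |1 - 2x|
   at [a] and [c], a lower bound for it at all other times outside ]a, c[ by monotonicity. *)
pose eta := Num.min (2 * expR (- (sg * a)) - 1) (1 - 2 * expR (- (sg * c))).
have eta0 : 0 < eta by rewrite lt_min; apply/andP; split; lra.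
have eta1 : eta <= 1 by rewrite ge_min; apply/orP; right; have := expR_ge0 (- (sg * c)); lra.
exists (1 - eta ^+ 2); split.
- by rewrite subr_ge0 expr_le1 ?(ltW eta0).
- by rewrite ltrBlDr ltrDl exprn_gt0.
move=> t t0 tac; rewrite laplace_bumpE lerD2l lerN2.
case: tac => [ta|ct].
- have h : eta <= 2 * expR (- (sg * t)) - 1.
    have : expR (- (sg * a)) <= expR (- (sg * t)) by rewrite ler_expR lerN2 ler_pM2l.
    by move=> h; rewrite ge_min; apply/orP; left; lra.
  by rewrite -[leRHS]sqrrN opprB lerXn2r// nnegrE ?(ltW eta0) ?(le_trans (ltW eta0) h).
- have h : eta <= 1 - 2 * expR (- (sg * t)).
    have : expR (- (sg * t)) <= expR (- (sg * c)) by rewrite ler_expR lerN2 ler_pM2l.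
    by move=> h; rewrite ge_min; apply/orP; right; lra.
  by rewrite lerXn2r// nnegrE ?(ltW eta0) ?(le_trans (ltW eta0) h).
Qed.

(** If F(t0) > 0, right-continuity gives F >= F(t0) / 2 on some ]t0, t0 + e[. Against powers of a
    bump peaking in its middle, a window around the peak contributes at least a constant times
    rho'^(M+j), and the times outside the interval at most a constant times rho^j with rho < rho'.
    The total being 0, large j gives a contradiction. *)
Lemma laplace_le0 {R : realType} (F : R -> R) (s0 : R) :
  (forall t, 0 < t -> F x @[x --> t^'+] --> F t) ->
  (forall s, s0 < s -> laplace_integrable F s /\ laplace F s = 0) ->
  forall t, 0 < t -> F t <= 0.
Proof.
move=> rcF F0 t0 t00; rewrite leNgt; apply/negP => Ft0.
have k0 : 0 < F t0 / 2 by rewrite divr_gt0.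
have [e /= e0 he] : exists2 e, 0 < e & forall t, t0 < t -> t < t0 + e -> F t0 / 2 <= F t.
  have /cvgrPdist_lt /(_ _ k0) [e /= e0 he] := rcF _ t00.
  exists e => // t t1 t2; have := he t; rewrite /ball_/= => /(_ _ t1).
  have -> : `|t0 - t| < e by rewrite ltr_norml; apply/andP; split; lra.
  by move=> /(_ isT); rewrite ltr_norml => /andP[_]; lra.
pose b := t0 + e / 2; pose c := t0 + e.
have ab : t0 < b by rewrite ltrDl divr_gt0.
have bc : b < c by rewrite /b /c ltrD2l; lra.
have b0 : 0 < b by exact: lt_trans ab.
have [sg [sg0 pb [rho [rho0 rho1 rhoP]]]] := laplace_bump_peak t00 ab bc.
(* Strictly between [rho] and the peak value 1, so that the bump stays above it in a neighbourhood
   of the peak. *)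
pose rho' := (1 + rho) / 2.
have rr : rho < rho' by rewrite /rho'; lra.
have r1 : rho' < 1 by rewrite /rho'; lra.
have rp0 : 0 < rho' by exact: le_lt_trans rr.
have [d d0 dP] : exists2 d, 0 < d & forall t, `|b - t| < d -> rho' <= laplace_bump sg t.
  have cb : {for b, continuous (laplace_bump sg)}.
    rewrite /laplace_bump; apply: continuousM.
      apply: continuousM; first exact: cst_continuous.
      apply: continuous_comp; last exact: continuous_expR.
      by apply: continuousN; exact: mulrl_continuous.
    apply: continuousB; first exact: cst_continuous.
    apply: continuous_comp; last exact: continuous_expR.
    by apply: continuousN; exact: mulrl_continuous.
  have r10 : 0 < 1 - rho' by rewrite subr_gt0.
  move/cvgrPdist_lt : cb => /(_ _ r10) [d /= d0 dP].
  exists d => // t td; have := dP t td; rewrite pb ltr_norml => /andP[_]; lra.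
pose d' := Num.min d (e / 2).
have d'0 : 0 < d' by rewrite lt_min d0 divr_gt0.
pose V := `]b - d', b + d'[%classic.
have VP t : V t -> [/\ t0 < t, t < c & rho' <= laplace_bump sg t].
  rewrite /V/= in_itv/= => /andP[t1 t2].
  have d1 : d' <= d by rewrite ge_min lexx.
  have d2 : d' <= e / 2 by rewrite ge_min lexx orbT.
  split; [move: t1; rewrite /b; lra|move: t2; rewrite /b /c; lra|].
  by apply: dP; rewrite ltr_norml; apply/andP; split; lra.
(* A fixed power [M] makes |F| times the weight integrable; only the additional power [j] grows. *)
have [M sM] : exists M : nat, s0 < sg * M%:R.
  exists (Num.bound `|s0 / sg|); rewrite mulrC -ltr_pdivrMr//.
  by apply: le_lt_trans (ler_norm _) _; exact: archi_boundP.
have [iM _] := laplace0_bump sg0 F0 sM.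
have iA : mu.-integrable `]0, +oo[ (fun t => (`|F t| * laplace_bump sg t ^+ M)%:E).
  have := integrable_norm iM.
  apply: eq_integrable => // t; rewrite inE/= in_itv/= andbT => tp.
  have /andP[w0 _] := laplace_bump_bounds sg0 tp.
  by rewrite normrM (ger0_norm (exprn_ge0 _ w0)).
pose A := \int[mu]_(t in `]0, +oo[) (`|F t| * laplace_bump sg t ^+ M).
have mV : measurable V by exact: measurable_itv.
have V0 : V `<=` `]0, +oo[%classic.
  by move=> t /VP[t1 _ _]; rewrite /= in_itv/= andbT (lt_trans t00).
have lV : lebesgue_measure V = (2 * d')%:E.
  rewrite /V lebesgue_measure_itv/= lte_fin ifT; last by lra.
  by rewrite -EFinB; congr EFin; ring.
have iV : mu.-integrable `]0, +oo[ (fun t => (\1_V t : R)%:E).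
  apply/integrableP; split.
    by apply/measurable_EFinP; exact: measurable_indic.
  under eq_integral do rewrite gee0_abs ?lee_fin//.
  by rewrite integral_indic//= setIidl// lV ltry.
have key j : F t0 / 2 * rho' ^+ M * (2 * d') <= A * (rho / rho') ^+ j.
  have sMj : s0 < sg * (M + j)%:R.
    by apply: (lt_le_trans sM); rewrite ler_pM2l// ler_nat leq_addr.
  have [i0 l0] := laplace0_bump sg0 F0 sMj.
  have i1 : mu.-integrable `]0, +oo[ (fun t => (F t0 / 2 * rho' ^+ (M + j) * \1_V t)%:E).
    have : mu.-integrable `]0, +oo[ (fun t => (F t0 / 2 * rho' ^+ (M + j))%:E * (\1_V t)%:E)%E.
      by apply: integrableZl => //; exact: iV.
    by [].
  have i2 : mu.-integrable `]0, +oo[ (fun t => (rho ^+ j * (`|F t| * laplace_bump sg t ^+ M))%:E).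
    have : mu.-integrable `]0, +oo[ (fun t => (rho ^+ j)%:E * (`|F t| * laplace_bump sg t ^+ M)%:E)%E.
      by apply: integrableZl => //; exact: iA.
    by [].
  (* The integrand lies below F times the full power of the bump: inside ]t0, c[ F is at least F(t0)
     / 2, and outside the bump is at most [rho]. *)
  have h : \int[mu]_(t in `]0, +oo[) (F t0 / 2 * rho' ^+ (M + j) * \1_V t -
      rho ^+ j * (`|F t| * laplace_bump sg t ^+ M)) <= 0.
    rewrite -[leRHS]l0; apply: le_Rintegral => //.
      have : mu.-integrable `]0, +oo[ ((fun t => (F t0 / 2 * rho' ^+ (M + j) * \1_V t)%:E) \-
         (fun t => (rho ^+ j * (`|F t| * laplace_bump sg t ^+ M))%:E))%E.
        exact: integrableB.
      by [].
    move=> t /=; rewrite in_itv/= andbT => tp.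
    have /andP[w0 w1] := laplace_bump_bounds sg0 tp.
    have [/andP[t1 t2]|tN] := boolP ((t0 < t) && (t < c)).
      have Ft := he _ t1 t2.
      have Ftp : 0 <= F t by apply: le_trans Ft; exact: ltW.
      have FA : 0 <= rho ^+ j * (`|F t| * laplace_bump sg t ^+ M).
        by rewrite !mulr_ge0 ?exprn_ge0.
      apply: (@le_trans _ _ (F t0 / 2 * rho' ^+ (M + j) * \1_V t)).
        by rewrite gerBl.
      rewrite indicE; have [|tV] := boolP (t \in V).
        rewrite inE => /VP[_ _ rw]; rewrite mulr1; apply: ler_pM => //.
          by rewrite ltW.
          by rewrite exprn_ge0// ltW.
        by rewrite lerXn2r// nnegrE ltW.
      by rewrite mulr0 mulr_ge0 ?exprn_ge0.
    rewrite indicE (_ : t \in V = false); last first.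
      apply/negP; rewrite inE => /VP[t1 t2 _].
      by move/negP : tN; apply; rewrite t1 t2.
    have wr : laplace_bump sg t <= rho.
      apply: rhoP => //; move: tN; rewrite negb_and -!leNgt => /orP[|]; [by left|by right].
    rewrite mulr0 sub0r.
    have : `|F t * laplace_bump sg t ^+ (M + j)| <= rho ^+ j * (`|F t| * laplace_bump sg t ^+ M).
      rewrite normrM (ger0_norm (exprn_ge0 _ w0)) exprD mulrA [leRHS]mulrC.
      by rewrite ler_wpM2l ?mulr_ge0 ?exprn_ge0// lerXn2r// nnegrE.
    by rewrite ler_norml => /andP[].
  move: h; rewrite RintegralB//.
  rewrite !RintegralZl// -/A.
  have -> : \int[mu]_(t in `]0, +oo[) \1_V t = 2 * d'.
    by rewrite /Rintegral integral_indic//= setIidl// lV.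
  rewrite subr_le0 exprD => h.
  rewrite (expr_div_n rho) [leRHS]mulrA ler_pdivlMr ?exprn_gt0//.
  by rewrite [leRHS]mulrC (mulrAC _ (2 * d')) -(mulrA (F t0 / 2)).
have r01 : `|rho / rho'| < 1.
  rewrite ger0_norm; last by rewrite divr_ge0// ltW.
  by rewrite ltr_pdivrMr// mul1r.
have cv : A * (rho / rho') ^+ j @[j --> \oo] --> A * 0.
  by apply: cvgM; [exact: cvg_cst|exact: cvg_expr].
have : F t0 / 2 * rho' ^+ M * (2 * d') <= A * 0.
  rewrite -(cvg_lim _ cv)//; apply: limr_ge; first exact: (cvgP _ cv).
  by apply: nearW => j; exact: key.
by rewrite mulr0 leNgt => /negP; apply; rewrite !mulr_gt0 ?exprn_gt0.
Qed.

Lemma laplace_unique {R : realType} (F G : R -> R) (s0 : R) :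
  (forall t, 0 < t -> F x @[x --> t^'+] --> F t) ->
  (forall t, 0 < t -> G x @[x --> t^'+] --> G t) ->
  (forall s, s0 < s -> [/\ laplace_integrable F s, laplace_integrable G s &
    laplace F s = laplace G s]) ->
  forall t, 0 < t -> F t = G t.
Proof.
have le (f g : R -> R) :
    (forall t, 0 < t -> f x @[x --> t^'+] --> f t) ->
    (forall t, 0 < t -> g x @[x --> t^'+] --> g t) ->
    (forall s, s0 < s -> [/\ laplace_integrable f s, laplace_integrable g s &
      laplace f s = laplace g s]) ->
    forall t, 0 < t -> f t <= g t.
  move=> cf cg fg t t0; rewrite -subr_le0.
  apply: (@laplace_le0 _ (fun t => f t - g t) s0) => //.
    by move=> u u0; apply: cvgB; [exact: cf|exact: cg].
  move=> s ss; have [i_f ig e] := fg s ss.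
  have [i_ e_] := laplace_linear 1 (-1) i_f ig.
  have E : (fun t => f t - g t) = (fun t => 1 * f t + -1 * g t).
    by apply/funext => u; rewrite mul1r mulN1r.
  by rewrite E e_ e mul1r mulN1r subrr.
move=> cF cG FG t t0; apply/eqP; rewrite eq_le; apply/andP; split.
  exact: le t0.
by apply: le t0 => // s ss; have [? ? ?] := FG s ss; split.
Qed.

(** * Inverse subordinators at exponential times and Poisson time change *)

Section inverse_path.
Context {d : measure_display} {T : measurableType d} {R : realType} (D : R -> T -> R) (w : T).
Hypothesis D_le : forall s t, 0 <= s -> s <= t -> D s w <= D t w.
Local Notation Y := (inverse_subordinator D).
Implicit Types s t y : R.

Let passage t : set R := [set s : R | 0 <= s /\ t < D s w].

Let has_lb t : has_lbound (passage t).
Proof. by exists 0 => s []. Qed.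

Lemma inverse_subordinator_ge0 t : 0 <= Y t w.
Proof.
rewrite /inverse_subordinator -/(passage t); have [->|/set0P ne] := eqVneq (passage t) set0.
  by rewrite inf0.
by apply: lb_le_inf => // s [].
Qed.

Lemma inverse_subordinator_le s t : 0 <= s -> t < D s w -> Y t w <= s.
Proof. by move=> s0 ts; apply: ge_inf; [exact: has_lb|split]. Qed.

Lemma inverse_subordinator_lt s t y : 0 <= s -> t < D s w -> Y t w < y ->
  exists u, [/\ 0 <= u, u < y & t < D u w].
Proof.
move=> s0 ts Yy; have ne : passage t !=set0 by exists s; split.
by have [u [u0 tu] uy] := inf_lt ne Yy; exists u.
Qed.

(** By monotonicity a path bounded by t at all integers never exceeds t, and the infimum of the
    empty set is 0. This is the degenerate branch of the pathwise lemmas. *)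
Lemma inverse_subordinator_out t : (forall n : nat, D n%:R w <= t) -> Y t w = 0.
Proof.
move=> Dt; rewrite /inverse_subordinator (_ : [set _ | _] = set0) ?inf0//.
rewrite -subset0 => s [s0 ts].
have sn : s <= (Num.bound s)%:R by exact/ltW/archi_boundP.
by have := le_lt_trans (le_trans (D_le s0 sn) (Dt _)) ts; rewrite ltxx.
Qed.

(** Expresses the event through countably many times, in preparation for measurability; the second
    alternative is the default value 0, which lies below y. *)
Lemma inverse_subordinator_ltP t y : 0 < y -> Y t w < y <->
  (exists q : rat, [/\ 0 <= ratr q :> R, ratr q < y & t < D (ratr q) w]) \/
  (forall n : nat, D n%:R w <= t).
Proof.
move=> y0; split=> [Yy|[[q [q0 qy tq]]|Dt]]; last 2 first.
- by apply: le_lt_trans qy; exact: inverse_subordinator_le.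
- by rewrite inverse_subordinator_out.
have [Dt|] := pselect (forall n : nat, D n%:R w <= t); first by right.
move=> /existsNP[n /negP]; rewrite -ltNge => tn; left.
have [u [u0 uy tu]] := inverse_subordinator_lt (ler0n _ n) tn Yy.
have [q] := rat_in_itvoo uy; rewrite in_itv/= => /andP[uq qy].
exists q; split=> //; first by rewrite (le_trans u0)// ltW.
by apply: (lt_le_trans tu); apply: D_le => //; exact: ltW.
Qed.

(** If u is just above Y(t) with D(u) > t, then u still bounds Y(v) for every v in ]t, D(u)[, and
    Y(v) >= Y(t). A path that never exceeds t gives the constant 0 from t on. *)
Lemma inverse_subordinator_right_continuous t : Y u w @[u --> t^'+] --> Y t w.
Proof.
have [Dt|] := pselect (forall n : nat, D n%:R w <= t).
  apply: cvg_near_cst; near=> u; apply/eqP; rewrite !inverse_subordinator_out// => n.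
  by apply: (le_trans (Dt n)); apply: ltW; near: u; exact: nbhs_right_gt.
move=> /existsNP[n /negP]; rewrite -ltNge => tn.
apply/cvgrPdist_lt => e e0.
have Ye : Y t w < Y t w + e by rewrite ltrDl.
have [u [u0 ue tu]] := inverse_subordinator_lt (ler0n _ n) tn Ye.
near=> v.
have tv : t < v by near: v; exact: nbhs_right_gt.
have vu : v < D u w by near: v; exact: nbhs_right_lt.
have h1 : Y v w <= u by exact: inverse_subordinator_le.
have h2 : Y t w <= Y v w.
  apply: lb_le_inf; first by exists u; split.
  move=> s [s0 vs]; apply: inverse_subordinator_le => //; exact: lt_trans vs.
rewrite ltr_norml; apply/andP; split; first by move: h1 h2 ue; lra.
by move: h2 e0; lra.
Unshelve. all: by end_near. Qed.

End inverse_path.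

(** Joint measurability in the sample point and the time is what allows the time to be randomised
    and Fubini to be applied. *)
Lemma measurable_inverse_subordinator {d : measure_display}
    {T : measurableType d} {R : realType} (D : R -> T -> R) :
  (forall s, 0 <= s -> measurable_fun setT (D s)) ->
  (forall w s t, 0 <= s -> s <= t -> D s w <= D t w) ->
  measurable_fun setT (fun z : T * R => inverse_subordinator D z.2 z.1).
Proof.
move=> mD D_le _; apply: (measurability _ (RGenInftyO.measurableE R)) => //.
move=> /= _ [_ [y ->] <-]; rewrite setTI.
have [y0|y0] := leP y 0.
  rewrite (_ : _ @^-1` _ = set0)//; apply/seteqP; split=> // z /=.
  rewrite in_itv/= => /lt_le_trans/(_ y0); apply/negP; rewrite -leNgt.
  by apply: inverse_subordinator_ge0.
rewrite (_ : _ @^-1` _ = (\bigcup_(q : rat)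
    (if (0 <= ratr q :> R) && (ratr q < y) then [set z : T * R | z.2 < D (ratr q) z.1] else set0))
  `|` (\bigcap_(n : nat) [set z : T * R | D n%:R z.1 <= z.2])); last first.
  apply/seteqP; split=> -[w t] /=; rewrite in_itv/=.
    move=> /(inverse_subordinator_ltP (D_le w) t y0)[[q [q0 qy tq]]|Dt]; last by right=> n _; exact: Dt.
    by left; exists q => //=; rewrite q0 qy.
  move=> H; apply/(inverse_subordinator_ltP (D_le w) t y0); case: H => [[q _]|Dt].
    by case: ifPn => // /andP[q0 qy] /= tq; left; exists q.
  by right=> n; have := Dt n I.
have mDz s : 0 <= s -> measurable_fun setT (fun z : T * R => D s z.1).
  by move=> s0; apply: measurableT_comp => //; exact: mD.
apply: measurableU.
  apply: bigcupT_measurable_rat => q; case: ifPn => // /andP[q0 _].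
  have := @measurable_fun_ltr _ _ R setT _ _ (@measurable_snd _ _ T R) (mDz _ q0).
  by move=> /(_ measurableT [set true] I); rewrite setTI.
apply: bigcapT_measurable => n.
have := @measurable_fun_ler _ _ R setT _ _ (mDz _ (ler0n _ n)) (@measurable_snd _ _ T R).
by move=> /(_ measurableT [set true] I); rewrite setTI.
Qed.

Lemma measurable_inverse_subordinator1 {d : measure_display}
    {T : measurableType d} {R : realType} (D : R -> T -> R) (t : R) :
  (forall s, 0 <= s -> measurable_fun setT (D s)) ->
  (forall w s t, 0 <= s -> s <= t -> D s w <= D t w) ->
  measurable_fun setT (inverse_subordinator D t).
Proof.
move=> mD D_le.
exact: measurable_fun_pair1 t (measurable_inverse_subordinator mD D_le).
Qed.

(** * Exponential laws *)

Import HBNNSimple.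

Definition exponential_law {R : realType} (r : R) (r0 : 0 < r) : probability (measurableTypeR R) R.
Proof.
unshelve refine (exponential_prob r : probability (measurableTypeR R) R).
exact: r0.
Defined.

(** Integration against the density: by definition for indicators, by linearity for simple
    functions, by monotone convergence in general. *)
Lemma integral_exponential_law {R : realType} (r : R) (r0 : 0 < r) (f : R -> \bar R) :
  measurable_fun setT f -> (forall x, 0 <= f x)%E ->
  (\int[exponential_law r0]_x f x =
   \int[mu]_(x in `]0%R, +oo[) (f x * (r * expR (- (r * x)))%:E))%E.
Proof.
move=> mf f0.
have mpdf : measurable_fun setT (exponential_pdf r) by exact: measurable_exponential_pdf.
have mpdfE : measurable_fun setT (fun x => (exponential_pdf r x)%:E) by exact/measurable_EFinP.
have pdf0 x : 0 <= exponential_pdf r x by apply: exponential_pdf_ge0; exact: ltW.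
transitivity (\int[mu]_x (f x * (exponential_pdf r x)%:E))%E; last first.
  have -> : (\int[mu]_x (f x * (exponential_pdf r x)%:E) =
     \int[mu]_(x in `[0%R, +oo[) (f x * (r * expR (- (r * x)))%:E))%E.
    rewrite [RHS]integral_mkcond; apply: eq_integral => x _.
    rewrite /exponential_pdf !patchE; case: ifPn => _; last by rewrite mule0.
    by rewrite mulNr.
  rewrite -integral_itv_obnd_cbnd//.
  apply: emeasurable_funM; first exact: measurable_funTS.
  by apply/measurable_EFinP; apply: measurable_funM => //; exact: measurable_expRN.
have indic (A : set R) : measurable A ->
    (\int[exponential_law r0]_x (\1_A x)%:E = \int[mu]_x ((\1_A x)%:E * (exponential_pdf r x)%:E))%E.
  move=> mA; rewrite integral_indic// setIT /= /exponential_prob.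
  rewrite [LHS]integral_mkcond; apply: eq_integral => x _.
  by rewrite patchE indicE; case: ifPn => _; rewrite ?mul1e ?mul0e.
(* From here on the law enters only through its values on indicators, so it is made abstract. *)
move: indic; move: (exponential_law r0) => nu indic.
pose f_ := nnsfun_approx measurableT mf.
have mfn n : measurable_fun setT (fun x : R => (f_ n x)%:E) by exact/measurable_EFinP.
have mono (x : R) : {homo (fun n => f_ n x) : a b / (a <= b)%N >-> a <= b}.
  by move=> a b ab; exact/lefP/nd_nnsfun_approx.
transitivity (limn (fun n => \int[nu]_x (f_ n x)%:E))%E.
  rewrite -monotone_convergence//=.
  - by apply: eq_integral => x _; apply/esym/cvg_lim => //; exact: cvg_nnsfun_approx.
  - by move=> n x _; rewrite lee_fin.
  - by move=> x _ a b ab; rewrite lee_fin mono.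
transitivity (limn (fun n => \int[mu]_x ((f_ n x)%:E * (exponential_pdf r x)%:E)))%E; last first.
  rewrite -monotone_convergence//=.
  - apply: eq_integral => x _; apply/cvg_lim => //; apply: cvgeZr => //.
    exact: cvg_nnsfun_approx.
  - by move=> n; apply: emeasurable_funM; [exact: mfn|exact: mpdfE].
  - by move=> n x _; rewrite -EFinM lee_fin mulr_ge0.
  - by move=> x _ a b ab; rewrite -!EFinM lee_fin ler_wpM2r// mono.
congr (limn _); apply/funext => n.
have mi c : measurable_fun setT (fun x : R => (\1_(f_ n @^-1` [set c]) x : R)%:E).
  exact/measurable_EFinP.
have mci c : measurable_fun setT (fun x : R => (c * \1_(f_ n @^-1` [set c]) x)%:E).
  by apply/measurable_EFinP; exact/measurable_funM.
under eq_integral do rewrite fimfunE -fsumEFin//.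
rewrite ge0_integral_fsum//; last first.
  by move=> c x _; rewrite EFinM nnfun_muleindic_ge0.
under [RHS]eq_integral.
  move=> x _; rewrite fimfunE -fsumEFin// ge0_mule_fsuml; last first.
    by move=> c; rewrite EFinM nnfun_muleindic_ge0.
  over.
rewrite [RHS]ge0_integral_fsum//; last 2 first.
  by move=> c; apply: emeasurable_funM; [exact: mci|exact: mpdfE].
  by move=> c x _; apply: mule_ge0; [rewrite EFinM nnfun_muleindic_ge0|rewrite lee_fin].
apply: eq_fsbigr => c /[!inE] -[x0 _ <-].
have c0 : 0 <= f_ n x0 by [].
under eq_integral do rewrite EFinM.
rewrite ge0_integralZl//; last exact: mi.
rewrite indic// -ge0_integralZl//; last 2 first.
- by apply: emeasurable_funM; [exact: mi|exact: mpdfE].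
- by move=> x _; rewrite -EFinM lee_fin mulr_ge0.
by apply: eq_integral => x _; rewrite EFinM muleA.
Qed.

(** Open upper rays are stable under intersection, generate the Borel sets and exhaust the line. *)
Lemma probability_eq_rays {R : realType} (p q : probability (measurableTypeR R) R) :
  (forall y : R, p `]y, +oo[%classic = q `]y, +oo[%classic) ->
  forall A : set R, measurable A -> p A = q A.
Proof.
move=> pq A mA.
apply: (@measure_unique _ R (measurableTypeR R)
  [set A : set R | exists y, A = `]y, +oo[%classic]
  (fun k : nat => `](- k%:R), +oo[%classic) _ _ _ _ p q) => //.
- exact: RGenOInfty.measurableE.
- move=> _ _ [y ->] [z ->]; exists (Num.max y z).
  by apply/seteqP; split=> x /=; rewrite !in_itv/= !andbT gt_max; [move=> [-> ->]|move=> /andP[]].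
- by move=> k; exists (- k%:R).
- rewrite -subTset => x _; exists (Num.bound x) => //=; rewrite in_itv/= andbT.
  by rewrite ltrNl unstable.ltrNbound.
- by move=> _ [y ->]; exact: pq.
- by move=> k; rewrite (le_lt_trans (probability_le1 _ _)) ?ltry//; exact: measurable_itv.
Qed.

Lemma exponential_law_ray {R : realType} (r : R) (r0 : 0 < r) (y : R) : 0 <= y ->
  exponential_law r0 `]y, +oo[%classic = (expR (- (r * y)))%:E.
Proof.
move=> y0; rewrite /= /exponential_prob.
have mE (E : set R) : measurable_fun E (fun x : R => (r * expR (- (r * x)))%:E).
  by apply/measurable_EFinP; apply: measurable_funM => //; exact: measurable_expRN.
transitivity (\int[mu]_(x in `]y, +oo[) (r * expR (- (r * x)))%:E)%E.
  apply: eq_integral => x; rewrite inE/= in_itv/= andbT => yx.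
  by rewrite exponential_pdfE ?(le_trans y0) ?(ltW yx)// mulNr.
rewrite (integral_affine y (oner_neq0 _))//.
have -> : (fun x : R => 1 * x + y) @^-1` `]y, +oo[ = `]0, +oo[%classic.
  by apply/seteqP; split=> x /=; rewrite !in_itv/= !andbT mul1r ltrDr.
rewrite normr1 mul1e.
transitivity (\int[mu]_(x in `]0%R, +oo[) ((r * expR (- (r * y)))%:E * (expR (- (r * x)))%:E))%E.
  apply: eq_integral => x _; rewrite -EFinM; congr EFin.
  by rewrite -mulrA -expRD; congr (_ * expR _); ring.
rewrite ge0_integralZl//.
- rewrite integral_expRN// -EFinM; congr EFin; field; exact: lt0r_neq0.
- by apply/measurable_EFinP; exact: measurable_expRN.
- by rewrite lee_fin mulr_ge0 ?expR_ge0// ltW.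
Qed.

Lemma exponential_law_ray_closed {R : realType} (r : R) (r0 : 0 < r) (y : R) : 0 <= y ->
  exponential_law r0 `[y, +oo[%classic = (expR (- (r * y)))%:E.
Proof.
move=> y0; rewrite -(exponential_law_ray r0 y0) /= /exponential_prob.
rewrite -integral_itv_obnd_cbnd//; apply/measurable_EFinP.
by apply: measurable_funTS; exact: measurable_exponential_pdf.
Qed.

Lemma exponential_law_neg_ray {R : realType} (r : R) (r0 : 0 < r) (y : R) : y < 0 ->
  exponential_law r0 `]y, +oo[%classic = 1%E.
Proof.
move=> y0; apply/eqP; rewrite eq_le probability_le1/=; last exact: measurable_itv.
have := exponential_law_ray r0 (lexx 0); rewrite mulr0 oppr0 expR0 => <-.
apply: le_measure; rewrite ?inE; try exact: measurable_itv.
by move=> x /=; rewrite !in_itv/= !andbT; exact: lt_trans.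
Qed.

Lemma convolution1_exprn {R : realType} (n : nat) (t : R) : 0 < t ->
  convolution (cst 1) (fun x => x ^+ n / n`!%:R) t = t ^+ n.+1 / n.+1`!%:R.
Proof.
move=> t0; rewrite /convolution.
under eq_Rintegral do rewrite mul1r.
have dF x : derivable (fun x : R => n.+1`!%:R^-1 * x ^+ n.+1) x 1.
  by apply: derivableM => //; exact: exprn_derivable.
have cF x : {for x, continuous (fun x : R => n.+1`!%:R^-1 * x ^+ n.+1)}.
  by apply: continuousM; [exact: cst_continuous|exact: exprn_continuous].
have cf x : {for x, continuous (fun x : R => x ^+ n / n`!%:R)}.
  by apply: continuousM; [exact: exprn_continuous|exact: cst_continuous].
have FTC : (\int[mu]_(x in `[0%R, t]) (x ^+ n / n`!%:R)%:E =
    (n.+1`!%:R^-1 * t ^+ n.+1)%:E - (n.+1`!%:R^-1 * 0 ^+ n.+1)%:E)%E.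
  rewrite (@continuous_FTC2 _ _ (fun x => n.+1`!%:R^-1 * x ^+ n.+1) _ _ t0)//.
  - by apply: continuous_subspaceT => x; exact: cf.
  - split; first by move=> x _; exact: dF.
      by apply: cvg_at_right_filter; exact: cF.
    by apply: cvg_at_left_filter; exact: cF.
  - move=> x _; rewrite derive1Ml; last exact: exprn_derivable.
    rewrite exp_derive1 /= factS natrM invfM -mulrA mulrCA /GRing.scale/= mulKf; last first.
      by rewrite pnatr_eq0.
    by rewrite mulrC.
rewrite /Rintegral -(@integral_itv_bndoo _ _ _ _ true false); last first.
  apply/measurable_EFinP/measurable_funTS; by apply: continuous_measurable_fun => x; exact: cf.
by rewrite FTC expr0n mulr0 sube0 mulrC.
Qed.

Lemma tame_exprn {R : realType} (n : nat) :
  tame n.+1%:R 0 (fun x : R => x ^+ n / n`!%:R).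
Proof.
split=> [t t0|].
  by apply: continuousM; [exact: exprn_continuous|exact: cst_continuous].
exists n`!%:R^-1; first by rewrite invr_ge0.
move=> t t0; rewrite mul0r expR0 mulr1 -natr1 addrK powR_mulrn ?(ltW t0)//.
by rewrite ger0_norm ?divr_ge0 ?exprn_ge0 ?(ltW t0)// mulrC.
Qed.

(** Convolving with the constant 1 raises x^n / n! to the next such monomial, so each degree
    multiplies the transform by that of 1, which is 1 / r. *)
Lemma laplace_exprn {R : realType} (n : nat) (r : R) : 0 < r ->
  laplace (fun x => x ^+ n / n`!%:R) r = r ^- n.+1.
Proof.
move=> r0; have L1 : laplace (cst 1) r = r^-1.
  rewrite /laplace; under eq_Rintegral do rewrite mul1r.
  by rewrite /Rintegral integral_expRN.
elim: n => [|n IH].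
  rewrite expr1 -L1; apply: eq_laplace => t t0.
  by rewrite expr0 fact0 divr1.
rewrite exprS invfM -{}IH -L1.
have t1 : tame 1 0 (cst 1 : R -> R).
  by apply: eq_tame (tame_exprn 0) => t t0; rewrite expr0 fact0 divr1.
rewrite -(laplace_convolution ltr01 (ltr0Sn _ n) r0 t1 (tame_exprn n)).
by apply: eq_laplace => t t0; rewrite convolution1_exprn.
Qed.

(** * First passage at an exponential time *)

Section exponential_time.
Context {d : measure_display} {T : measurableType d} {R : realType}.
Variables (P : probability T R) (D : R -> T -> R) (phi : R -> R).
Hypothesis mD : forall s, 0 <= s -> measurable_fun setT (D s).
Hypothesis D_le : forall w s t, 0 <= s -> s <= t -> D s w <= D t w.
Hypothesis rcD : forall w t, 0 <= t -> D s w @[s --> t^'+] --> D t w.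
Hypothesis D0 : {ae P, forall w, D 0 w = 0}.
Hypothesis phi_gt0 : forall s, 0 < s -> 0 < phi s.
Hypothesis laplaceD : forall s t, 0 <= s -> 0 <= t ->
  (\int[P]_w (expR (- (s * D t w)))%:E = (expR (- (t * phi s)))%:E)%E.

Let mexpD s t : 0 <= t -> measurable_fun setT (fun w => (expR (- (s * D t w)))%:E).
Proof.
move=> t0; apply/measurable_EFinP; apply: measurableT_comp => //.
by apply: measurableT_comp => //; apply: measurable_funM => //; exact: mD.
Qed.

(** On the event [Z k] that the path stays below k, e^(-D(m)) >= e^(-k) for all m. Hence P(Z k)
    e^(-k) <= E e^(-D(m)) = e^(-m phi(1)), which tends to 0 as phi(1) > 0. *)
Lemma subordinator_unbounded : {ae P, forall w, forall x, exists n : nat, x < D n%:R w}.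
Proof.
pose Z (k : nat) := \bigcap_(n : nat) [set w | D n%:R w <= k%:R].
have mZ k : measurable (Z k).
  apply: bigcapT_measurable => n.
  have := @measurable_fun_ler _ _ R setT _ _ (mD (ler0n _ n)) (@measurable_cst _ _ T R setT k%:R).
  by move=> /(_ measurableT [set true] I); rewrite setTI.
have Z0 k : P (Z k) = 0%E.
  have h m : (P (Z k) * (expR (- k%:R))%:E <= (expR (- phi 1) ^+ m)%:E)%E.
    have -> : expR (- phi 1) ^+ m = expR (- (m%:R * phi 1)).
      by rewrite -expRM_natr; congr expR; ring.
    rewrite -(laplaceD ler01 (ler0n _ m)).
    have -> : P (Z k) = (\int[P]_w (\1_(Z k) w : R)%:E)%E by rewrite integral_indic// setIT.
    rewrite -ge0_integralZr//; [|by apply/measurable_EFinP; exact: measurable_indic].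
    apply: ge0_le_integral => //.
    - apply: emeasurable_funM => //.
      by apply/measurable_EFinP; exact: measurable_indic.
    - exact: mexpD.
    move=> w _; rewrite -EFinM lee_fin indicE.
    have [|_] := boolP (w \in Z k); last by rewrite mul0r expR_ge0.
    by rewrite inE mul1r ler_expR mul1r lerN2 => /(_ m I).
  have fP : P (Z k) \is a fin_num by rewrite fin_num_measure.
  have h' m : fine (P (Z k)) * expR (- k%:R) <= expR (- phi 1) ^+ m.
    by rewrite -lee_fin EFinM fineK.
  have e1 : `|expR (- phi 1)| < 1.
    by rewrite ger0_norm ?expR_ge0// expR_lt1 oppr_lt0 phi_gt0.
  have h0 : fine (P (Z k)) * expR (- k%:R) <= 0.
    rewrite -(cvg_lim _ (cvg_expr e1))//; apply: limr_ge; first exact: (cvgP _ (cvg_expr e1)).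
    exact: nearW.
  rewrite -(fineK fP); congr EFin; apply/eqP; rewrite eq_le fine_ge0// andbT.
  by move: h0; rewrite pmulr_lle0// expR_gt0.
have nZ : P.-negligible (\bigcup_k Z k).
  by apply: negligible_bigcup => k; apply/negligibleP => //; exact: Z0.
apply: negligibleS nZ => w /= /existsNP[x /forallNP wx].
exists (Num.bound x) => // n _ /=; have /negP := wx n; rewrite -leNgt => /le_trans; apply.
exact/ltW/unstable.ltr_bound.
Qed.

(** For almost every path the set of t with Y(t) > y lies between ]D(y), +oo[ and [D(y), +oo[, which
    have the same exponential mass. D(0) = 0 makes D(y) nonnegative, and unboundedness excludes the
    default value of the infimum. *)
Lemma exponential_passage_law s (s0 : 0 < s) y : 0 <= y ->
  {ae P, forall w, exponential_law s0 [set t | y < inverse_subordinator D t w] =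
    (expR (- (s * D y w)))%:E}.
Proof.
move=> y0; apply: filterS2 D0 subordinator_unbounded => w Dw0 Dub.
have Dy0 : 0 <= D y w by rewrite -Dw0; exact: D_le.
have mS : measurable ([set t | y < inverse_subordinator D t w] : set (measurableTypeR R)).
  have mYw : measurable_fun setT (fun t => inverse_subordinator D t w).
    exact: measurable_fun_pair2 w (measurable_inverse_subordinator mD D_le).
  have := @measurable_fun_ltr _ _ R setT _ _ (@measurable_cst _ _ R R setT y) mYw.
  by move=> /(_ measurableT [set true] I); rewrite setTI.
apply/eqP; rewrite eq_le; apply/andP; split.
- rewrite -(exponential_law_ray_closed s0 Dy0); apply: le_measure; rewrite ?inE//.
  move=> t /= yY; rewrite in_itv/= andbT leNgt; apply/negP => tD.
  by have := inverse_subordinator_le y0 tD; rewrite leNgt yY.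
- rewrite -(exponential_law_ray s0 Dy0); apply: le_measure; rewrite ?inE//.
  move=> t /=; rewrite in_itv/= andbT => Dt.
  (* Right-continuity at y provides u > y with D(u) < t; every time at which D exceeds t is then at
     least u, so Y(t) >= u > y. *)
  have [u yu Du] : exists2 u, y < u & D u w < t.
    have tD : 0 < t - D y w by rewrite subr_gt0.
    have /cvgrPdist_lt /(_ _ tD) h := @rcD w y y0.
    near (y^'+) => u; exists u; first by near: u; exact: nbhs_right_gt.
    have : `|D y w - D u w| < t - D y w by near: u.
    by rewrite ltr_norml opprB ltrD2l ltrN2 => /andP[].
  apply: (lt_le_trans yu).
  have [n tn] := Dub t.
  apply: lb_le_inf; first by exists n%:R; split.
  move=> v [v0 tv]; rewrite leNgt; apply/negP => vu.
  by have := lt_trans (lt_le_trans tv (@D_le w _ _ v0 (ltW vu))) Du; rewrite ltxx.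
Unshelve. all: by end_near. Qed.

(** The exponential time lives on the second factor of a product space. The image law of (w, t) ->
    Y(t)(w) has tail E e^(-s D(y)) = e^(-y phi(s)), so it is exponential of rate phi(s); Tonelli
    turns this into the iterated integral. *)
Lemma integral_inverse_subordinator s (s0 : 0 < s) (f : R -> \bar R) :
  measurable_fun setT f -> (forall y, 0 <= f y)%E ->
  (\int[exponential_law s0]_t \int[P]_w f (inverse_subordinator D t w) =
   \int[exponential_law (phi_gt0 s0)]_y f y)%E.
Proof.
move=> mf f0.
pose Yz (z : T * measurableTypeR R) : measurableTypeR R := inverse_subordinator D z.2 z.1.
have mY : measurable_fun setT Yz := measurable_inverse_subordinator mD D_le.
pose X : {mfun (T * measurableTypeR R)%type >-> measurableTypeR R} :=
  HB.pack Yz (isMeasurableFun.Build _ _ _ _ _ mY).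
have ray y : distribution (P \x exponential_law s0)%E X `]y, +oo[%classic =
    exponential_law (phi_gt0 s0) `]y, +oo[%classic.
  have [y0|y0] := ltP y 0.
    rewrite exponential_law_neg_ray// /distribution /pushforward.
    rewrite (_ : X @^-1` _ = setT) ?probability_setT//.
    apply/seteqP; split=> // z _ /=; rewrite in_itv/= andbT (lt_le_trans y0)//.
    exact: inverse_subordinator_ge0.
  rewrite exponential_law_ray// (mulrC (phi s)) -(laplaceD (ltW s0) y0).
  rewrite /distribution /pushforward /product_measure1.
  apply: ae_eq_integral => //.
  - apply: measurable_fun_xsection; rewrite -[X in measurable X]setTI.
    exact: (mY measurableT _ (measurable_itv _)).
  - exact: mexpD.
  - apply: filterS (exponential_passage_law s0 y0) => w <- _ /=.
    congr (exponential_law s0 _); apply/seteqP; split=> t /=.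
      by rewrite /xsection/= inE/= in_itv/= andbT.
    by rewrite /xsection/= inE/= in_itv/= andbT.
transitivity (\int[distribution (P \x exponential_law s0)%E X]_y f y)%E; last first.
  by apply: eq_measure_integral => A mA _; exact: probability_eq_rays.
rewrite ge0_integral_distribution//.
have mfX : measurable_fun setT (f \o X) by apply: (measurableT_comp mf).
rewrite (@fubini_tonelli2 _ _ _ _ R P (exponential_law s0) (f \o X))// => z; exact: f0.
Qed.
End exponential_time.

(* The absolute value only serves to make the weight nonnegative and bounded on
   the whole line; it is evaluated at nonnegative times. *)
Definition poisson_weight {R : realType} (lambda : R) (n : nat) (y : R) : R :=
  (lambda * `|y|) ^+ n / n`!%:R * expR (- (lambda * `|y|)).

Lemma poisson_weight_ge0 {R : realType} (lambda : R) (n : nat) (y : R) :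
  0 < lambda -> 0 <= poisson_weight lambda n y.
Proof.
by move=> l0; rewrite !mulr_ge0 ?expR_ge0 ?invr_ge0// exprn_ge0// mulr_ge0// ltW.
Qed.

Lemma poisson_weight_le1 {R : realType} (lambda : R) (n : nat) (y : R) :
  0 < lambda -> poisson_weight lambda n y <= 1.
Proof.
move=> l0; rewrite /poisson_weight expRN ler_pdivrMr ?expR_gt0// mul1r.
have x0 : 0 <= lambda * `|y| by rewrite mulr_ge0// ltW.
case: n => [|n]; first by rewrite expr0 fact0 divr1 -expR0 ler_expR.
by apply: le_trans (expR_ge1Dxn n x0); rewrite lerDr.
Qed.

Lemma continuous_poisson_weight {R : realType} (lambda : R) (n : nat) (y : R) :
  {for y, continuous (poisson_weight lambda n)}.
Proof.
have cl : {for y, continuous (fun y : R => lambda * `|y|)}.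
  by apply: continuousM; [exact: cst_continuous|exact: norm_continuous].
apply: continuousM.
  apply: continuousM; last exact: cst_continuous.
  by apply: (@continuous_comp _ _ _ (fun y : R => lambda * `|y|) (fun x => x ^+ n) y cl);
    exact: exprn_continuous.
apply: (@continuous_comp _ _ _ (fun y : R => - (lambda * `|y|)) expR y); last exact: continuous_expR.
exact: continuousN.
Qed.

Lemma measurable_poisson_weight {R : realType} (lambda : R) (n : nat) :
  measurable_fun setT (poisson_weight lambda n).
Proof. by apply: continuous_measurable_fun => y; exact: continuous_poisson_weight. Qed.


Section poisson_weight_transform.
Context {d : measure_display} {T : measurableType d} {R : realType}.
Variables (P : probability T R) (D : R -> T -> R) (phi : R -> R).
Variables (lambda : R) (n : nat).
Hypothesis l0 : 0 < lambda.
Hypothesis mD : forall s, 0 <= s -> measurable_fun setT (D s).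
Hypothesis D_le : forall w s t, 0 <= s -> s <= t -> D s w <= D t w.

Let p t : R := \int[P]_w poisson_weight lambda n (inverse_subordinator D t w).

Let mw t : measurable_fun setT (fun w => poisson_weight lambda n (inverse_subordinator D t w)).
Proof.
apply: (measurableT_comp (measurable_poisson_weight lambda n)).
exact: measurable_inverse_subordinator1.
Qed.

Lemma integrable_poisson_weight t : P.-integrable setT
  (fun w => (poisson_weight lambda n (inverse_subordinator D t w))%:E).
Proof.
have i1 : P.-integrable setT (cst 1%E) by apply/finite_measure_integrable_cst.
apply: le_integrable i1 => //; first by apply/measurable_EFinP; exact: mw.
move=> w _; rewrite lee_fin normr1 ger0_norm ?poisson_weight_ge0//.
exact: poisson_weight_le1.
Qed.

Let pE t : (\int[P]_w (poisson_weight lambda n (inverse_subordinator D t w))%:E = (p t)%:E)%E.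
Proof. by rewrite /p /Rintegral fineK//; exact: (integrable_fin_num _ (integrable_poisson_weight t)). Qed.

Let p_ge0 t : 0 <= p t.
Proof. by apply: Rintegral_ge0 => w _; exact: poisson_weight_ge0. Qed.

Let p_le1 t : p t <= 1.
Proof.
rewrite -lee_fin -pE -(@probability_setT _ _ _ P) -[leRHS]mul1e -(integral_cst P measurableT 1).
apply: ge0_le_integral => //.
- by move=> w _; rewrite lee_fin poisson_weight_ge0.
- by apply/measurable_EFinP; exact: mw.
- by move=> w _; rewrite lee_fin poisson_weight_le1.
Qed.

(** A partial integral of a jointly measurable nonnegative function, hence measurable by Tonelli. *)
Let mp : measurable_fun setT p.
Proof.
suff : measurable_fun setT (fun t : R => (p t)%:E) by move/measurable_EFinP.
have -> : (fun t : R => (p t)%:E) = fubini_G P (fun z : T * R =>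
    (poisson_weight lambda n (inverse_subordinator D z.2 z.1))%:E).
  by apply/funext => t; rewrite /fubini_G /= pE.
apply: measurable_fun_fubini_tonelli_G.
- apply/measurable_EFinP; apply: (measurableT_comp (measurable_poisson_weight lambda n)).
  exact: measurable_inverse_subordinator.
- by move=> z; rewrite lee_fin poisson_weight_ge0.
Qed.

Lemma laplace_integrable_poisson_weight s : 0 < s -> laplace_integrable p s.
Proof.
move=> s0; have i1 := integrable_powR_expRN ltr01 s0.
apply: le_integrable i1 => //.
  apply/measurable_EFinP; apply: measurable_funM; first exact: measurable_funTS.
  exact: measurable_expRN.
move=> t _; rewrite subrr powRr0 mul1r lee_fin normrM ler_piMl//.
by rewrite ger0_norm.
Qed.

(** The paths of Y are right-continuous and the weight is continuous and at most 1, so dominated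
    convergence applies along sequences approaching t from the right. *)
Lemma right_continuous_poisson_weight t : 0 < t -> p x @[x --> t^'+] --> p t.
Proof.
move=> t0; apply/cvg_at_rightP => u [tu ut].
have i1 : P.-integrable setT (cst 1%E) by apply/finite_measure_integrable_cst.
have := @dominated_convergence _ _ R P setT measurableT
  (fun k w => (poisson_weight lambda n (inverse_subordinator D (u k) w))%:E)
  (fun w => (poisson_weight lambda n (inverse_subordinator D t w))%:E) (cst 1%E) _ _ _ i1 _.
case=> [k| | | |_ _ cvf].
- by apply/measurable_EFinP; exact: mw.
- by apply/measurable_EFinP; exact: mw.
- apply: aeW => w _; apply: cvg_EFin; first exact: nearW.
  apply: continuous_cvg; first exact: continuous_poisson_weight.
  by have /cvg_at_rightP := @inverse_subordinator_right_continuous _ _ _ D w (D_le w) t; apply.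
- apply: aeW => w k _; rewrite lee_fin ger0_norm ?poisson_weight_ge0//.
  exact: poisson_weight_le1.
have -> : (fun k => p (u k)) = fine \o (fun k =>
    \int[P]_w (poisson_weight lambda n (inverse_subordinator D (u k) w))%:E)%E.
  by apply/funext => k /=; rewrite pE.
by apply: fine_cvg; rewrite -pE.
Qed.

Hypothesis rcD : forall w t, 0 <= t -> D s w @[s --> t^'+] --> D t w.
Hypothesis D0 : {ae P, forall w, D 0 w = 0}.
Hypothesis phi_gt0 : forall s, 0 < s -> 0 < phi s.
Hypothesis laplaceD : forall s t, 0 <= s -> 0 <= t ->
  (\int[P]_w (expR (- (s * D t w)))%:E = (expR (- (t * phi s)))%:E)%E.

(** In the identity at an exponential time both sides are transforms: the left is s times that of
    [p], the right phi(s) lambda^n times that of x^n / n! at lambda + phi(s), the factor e^(-lambda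
    x) of the weight shifting the argument. *)
Lemma laplace_poisson_weight s : 0 < s ->
  laplace p s = phi s / s * lambda ^+ n / (lambda + phi s) ^+ n.+1.
Proof.
move=> s0; have f0 : 0 < phi s by exact: phi_gt0.
have lf0 : 0 < lambda + phi s by rewrite addr_gt0.
have mwE : measurable_fun setT (fun y => (poisson_weight lambda n y)%:E).
  by apply/measurable_EFinP; exact: measurable_poisson_weight.
have wE0 y : (0 <= (poisson_weight lambda n y)%:E)%E by rewrite lee_fin poisson_weight_ge0.
have := integral_inverse_subordinator mD D_le rcD D0 phi_gt0 laplaceD s0 mwE wE0.
under eq_integral do rewrite pE.
have mpE : measurable_fun setT (fun t : R => (p t)%:E) by apply/measurable_EFinP; exact: mp.
have pE0 t : (0 <= (p t)%:E)%E by rewrite lee_fin.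
rewrite (@integral_exponential_law _ _ s0 (fun t => (p t)%:E) mpE pE0).
rewrite (@integral_exponential_law _ _ (phi_gt0 s0) _ mwE wE0).
have -> : (\int[mu]_(x in `]0%R, +oo[) ((p x)%:E * (s * expR (- (s * x)))%:E) =
    (s * laplace p s)%:E)%E.
  transitivity (\int[mu]_(x in `]0%R, +oo[) (s%:E * (p x * expR (- (s * x)))%:E))%E.
    by apply: eq_integral => x _; rewrite -!EFinM; congr EFin; ring.
  rewrite integralZl//; last exact: laplace_integrable_poisson_weight.
  rewrite [RHS]EFinM /laplace /Rintegral fineK//.
  exact: (integrable_fin_num _ (laplace_integrable_poisson_weight s0)).
have ix : mu.-integrable `]0, +oo[ (fun x : R =>
    (x ^+ n / n`!%:R * expR (- ((lambda + phi s) * x)))%:E).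
  exact: (tame_laplace_integrable (ltr0Sn _ n) lf0 (tame_exprn n)).
have -> : (\int[mu]_(x in `]0%R, +oo[) ((poisson_weight lambda n x)%:E * (phi s * expR (- (phi s * x)))%:E) =
    (phi s * lambda ^+ n * (lambda + phi s) ^- n.+1)%:E)%E.
  transitivity (\int[mu]_(x in `]0%R, +oo[) ((phi s * lambda ^+ n)%:E *
      (x ^+ n / n`!%:R * expR (- ((lambda + phi s) * x)))%:E))%E.
    apply: eq_integral => x; rewrite inE/= in_itv/= andbT => x0.
    rewrite -!EFinM; congr EFin; rewrite /poisson_weight gtr0_norm// mulrDl opprD expRD exprMn.
    by ring.
  rewrite integralZl//.
  rewrite [RHS]EFinM -(laplace_exprn n lf0) /laplace /Rintegral fineK//.
  exact: (integrable_fin_num _ ix).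
move=> [] E; apply: (mulfI (lt0r_neq0 s0)); rewrite E.
by field; rewrite ?expf_neq0 ?lt0r_neq0.
Qed.

End poisson_weight_transform.

(** * A counting process at an independent random time *)

Section time_change.
Context {d : measure_display} {T : measurableType d} {R : realType}.
Variables (P : probability T R) (N : R -> T -> nat) (V : T -> R) (n : nat) (q : R -> R).
Hypothesis mN : forall s, 0 <= s -> measurable [set w | N s w = n].
Hypothesis rcN : forall w t, 0 <= t ->
  ((N s w)%:R : R) @[s --> t^'+] --> ((N t w)%:R : R).
Hypothesis mV : measurable_fun setT V.
Hypothesis V0 : forall w, 0 <= V w.
Hypothesis q0 : forall y, 0 <= q y.
Hypothesis q1 : forall y, q y <= 1.
Hypothesis cq : forall y, {for y, continuous q}.
Hypothesis Nq : forall y, 0 < y -> P [set w | N y w = n] = (q y)%:E.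
Hypothesis indep : forall y (B : set R), 0 < y -> measurable B ->
  P ([set w | N y w = n] `&` V @^-1` B) = (P [set w | N y w = n] * P (V @^-1` B))%E.

(* [V] is approximated from strictly above by the next point of the grid of mesh
   [m.+1%:R^-1]; right-continuity of the paths makes the limit [m --> oo] exact. *)
Let grid (m j : nat) : R := j.+1%:R / m.+1%:R.
Let cell (m j : nat) : set R := `[j%:R / m.+1%:R, grid m j[%classic.
Let tau (m : nat) (w : T) : R := grid m (Num.trunc (V w * m.+1%:R)).

Let m0 (m : nat) : 0 < m.+1%:R :> R. Proof. by []. Qed.

(** Grid points are positive even for the cell at 0, so the law of N is used at positive times
    alone, including when V vanishes. *)
Let grid0 m j : 0 < grid m j. Proof. by rewrite divr_gt0. Qed.

Let cellP m j w : cell m j (V w) <-> Num.trunc (V w * m.+1%:R) = j.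
Proof.
rewrite /cell /grid/= in_itv/= ler_pdivrMr// ltr_pdivlMr//.
rewrite -truncn_eq; last by rewrite mulr_ge0.
by split=> /eqP.
Qed.

Let mcell m j : measurable (V @^-1` cell m j).
Proof. by rewrite -[X in measurable X]setTI; apply: mV => //; exact: measurable_itv. Qed.

Let trivIset_cell m : trivIset setT (fun j => V @^-1` cell m j).
Proof.
apply/trivIsetP => i j _ _ /eqP ij; rewrite -subset0 => w [/cellP Vi /cellP Vj].
by apply: ij; rewrite -Vi.
Qed.

Let bigcup_cell m : \bigcup_j (V @^-1` cell m j) = setT.
Proof. by rewrite -subTset => w _; exists (Num.trunc (V w * m.+1%:R)) => //; exact/cellP. Qed.

Let mtau m : measurable_fun setT (tau m).
Proof.
rewrite -(bigcup_cell m); apply/measurable_fun_bigcup => // j.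
apply: (eq_measurable_fun (cst (grid m j))); last exact: measurable_cst.
by move=> w; rewrite inE => /cellP; rewrite /tau => ->.
Qed.

Let tau_gt m w : V w < tau m w.
Proof.
have h0 : 0 <= V w * m.+1%:R by rewrite mulr_ge0.
have /andP[_ h] := truncn_itv h0.
by rewrite /tau /grid ltr_pdivlMr.
Qed.

Let tau_cvg w : tau m w @[m --> \oo] --> V w.
Proof.
have h m : tau m w <= V w + m.+1%:R^-1.
  have h0 : 0 <= V w * m.+1%:R by rewrite mulr_ge0.
  have /andP[h _] := truncn_itv h0.
  by rewrite /tau /grid ler_pdivrMr// mulrDl mulVf ?gt_eqF// -natr1 lerD2r.
apply: (squeeze_cvgr (f := cst (V w)) (h := fun m => V w + m.+1%:R^-1)).
- by apply: nearW => m; apply/andP; split; [apply/ltW; exact: tau_gt|exact: h].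
- exact: cvg_cst.
- rewrite -[X in _ --> X]addr0; apply: cvgD; [exact: cvg_cst|exact: cvg_harmonic].
Qed.

Let E m : set T := [set w | N (tau m w) w = n].

Let EE m : E m = \bigcup_j ([set w | N (grid m j) w = n] `&` V @^-1` cell m j).
Proof.
apply/seteqP; split=> w.
  by move=> Nw; exists (Num.trunc (V w * m.+1%:R)) => //; split=> //; exact/cellP.
by move=> [j _ [/= Nw /cellP Vj]]; rewrite /E/= /tau Vj.
Qed.

Let mEj m j : measurable ([set w | N (grid m j) w = n] `&` V @^-1` cell m j).
Proof. by apply: measurableI => //; apply: mN; exact: ltW. Qed.

Let mE m : measurable (E m).
Proof. by rewrite EE; exact: bigcup_measurable. Qed.

Let mq : measurable_fun setT q.
Proof. by apply: continuous_measurable_fun => y; exact: cq. Qed.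

(** On each cell [tau m] is a deterministic time, so independence factorises the probability and [q]
    is constant there; summing over the disjoint cells gives the integral. *)
Let PE m : P (E m) = (\int[P]_w (q (tau m w))%:E)%E.
Proof.
rewrite EE measure_bigcup//; last first.
  apply/trivIsetP => i j _ _ /eqP ij; rewrite -subset0 => w [[_ /cellP Vi] [_ /cellP Vj]].
  by apply: ij; rewrite -Vi.
rewrite -[in RHS](bigcup_cell m) ge0_integral_bigcup//; last 2 first.
- rewrite bigcup_cell; apply/measurable_EFinP.
  exact: (measurableT_comp mq).
- by move=> w _; rewrite lee_fin.
rewrite (eq_eseriesl (Q := xpredT)); last by move=> j; rewrite in_setT.
apply: eq_eseriesr => j _.
transitivity (P [set w | N (grid m j) w = n] * P (V @^-1` cell m j))%E.
  by apply: indep => //; exact: measurable_itv.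
rewrite Nq// -integral_cst//; apply: eq_integral => w.
by rewrite inE => /cellP; rewrite /tau => ->.
Qed.

(** Values of N are integers: once they differ by less than 1 they are equal, so right-continuity
    makes the indicators eventually constant. *)
Let E_cvg w : (\1_(E m) w : R) @[m --> \oo] --> (\1_[set w | N (V w) w = n] w : R).
Proof.
have cN : ((N (tau m w) w)%:R : R) @[m --> \oo] --> ((N (V w) w)%:R : R).
  have /cvg_at_rightP := @rcN w (V w) (V0 w); apply; split; last exact: tau_cvg.
  by move=> m; exact: tau_gt.
apply: cvg_near_cst.
have /cvgrPdist_lt /(_ _ ltr01) := cN.
apply: filterS => m; rewrite !indicE => h.
suff -> : (w \in E m) = (w \in [set w | N (V w) w = n]) by [].
suff h' : N (tau m w) w = N (V w) w by apply/idP/idP; rewrite !inE /E/= h'.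
move: h; rewrite ltr_norml => /andP[h1 h2].
have [lt|lt|//] := ltngtP (N (tau m w) w) (N (V w) w).
- by move: h2; rewrite ltrBlDr nat1r ltr_nat ltnNge lt.
- by move: h1; rewrite ltrBrDr addrC ltrBlDr natr1 ltr_nat ltnNge lt.
Qed.

Lemma measurable_time_change : measurable [set w | N (V w) w = n].
Proof.
apply/(@measurable_indicP _ _ R); apply: (measurable_fun_cvg (h := fun m => \1_(E m))).
  by move=> m; exact: measurable_indic.
by move=> w _; exact: E_cvg.
Qed.

(** The identity on the grid passes to the limit by dominated convergence on both sides: indicators
    on the left, the continuous bounded [q] on the right. *)
Lemma time_change_distribution :
  P [set w | N (V w) w = n] = (\int[P]_w (q (V w))%:E)%E.
Proof.
have mL := measurable_time_change.
have i1 : P.-integrable setT (cst 1%E) by apply/finite_measure_integrable_cst.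
have := @dominated_convergence _ _ R P setT measurableT
  (fun m w => (\1_(E m) w : R)%:E) (fun w => (\1_[set w | N (V w) w = n] w : R)%:E) (cst 1%E) _ _ _ i1 _.
case=> [m| | | |_ _ c1].
- by apply/measurable_EFinP; exact: measurable_indic.
- by apply/measurable_EFinP; exact: measurable_indic.
- by apply: aeW => w _; apply: cvg_EFin; [exact: nearW|exact: E_cvg].
- by apply: aeW => w m _; rewrite lee_fin indicE; case: (_ \in _); rewrite ?normr1 ?normr0.
have := @dominated_convergence _ _ R P setT measurableT
  (fun m w => (q (tau m w))%:E) (fun w => (q (V w))%:E) (cst 1%E) _ _ _ i1 _.
case=> [m| | | |_ _ c2].
- by apply/measurable_EFinP; exact: (measurableT_comp mq).
- by apply/measurable_EFinP; exact: (measurableT_comp mq).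
- apply: aeW => w _; apply: cvg_EFin; first exact: nearW.
  by apply: continuous_cvg; [exact: cq|exact: tau_cvg].
- by apply: aeW => w m _; rewrite lee_fin ger0_norm.
have e1 : (fun m => \int[P]_w (\1_(E m) w : R)%:E)%E = (fun m => \int[P]_w (q (tau m w))%:E)%E.
  by apply/funext => m; rewrite -PE integral_indic// setIT.
rewrite /= e1 in c1; have := cvg_unique _ c1 c2 => /(_ (@ereal_hausdorff R)).
by move=> <-; rewrite integral_indic// setIT.
Qed.

End time_change.

(** * Transform of the state probabilities and conclusion *)

Lemma subordinator_le {d : measure_display} {T : measurableType d} {R : realType}
    (P : probability T R) (D : R -> T -> R) : subordinator P D ->
  forall w s t, 0 <= s -> s <= t -> D s w <= D t w.
Proof. by move=> [_ h] w s t; exact: h. Qed.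

Lemma ae_eq_probability {d : measure_display} {T : measurableType d} {R : realType}
    (P : probability T R) (A B : set T) : measurable A -> measurable B ->
  {ae P, forall w, A w <-> B w} -> P A = P B.
Proof.
move=> mA mB AB; rewrite -[A]setIT -[B]setIT -!integral_indic//.
apply: ae_eq_integral => //.
- by apply/measurable_EFinP; exact: measurable_indic.
- by apply/measurable_EFinP; exact: measurable_indic.
apply: filterS AB => w AB _; rewrite !indicE.
suff -> : (w \in A) = (w \in B) by [].
by apply/idP/idP; rewrite !inE => /AB.
Qed.

Lemma poisson_process_measurable {d : measure_display} {T : measurableType d}
    {R : realType} (P : probability T R) (lambda : R) (N : R -> T -> nat) (s : R) (n : nat) :
  poisson_process P lambda N -> 0 <= s -> measurable [set w | N s w = n].
Proof.
move=> [[mN _ _ _ _ _] _] s0.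
rewrite (_ : [set w | N s w = n] = setT `&` (fun w => (N s w)%:R : R) @^-1` [set n%:R]).
  by apply: mN.
rewrite setTI; apply/seteqP; split=> w /=; first by move=> ->.
by move=> /eqP; rewrite eqr_nat => /eqP.
Qed.

(** The definition prescribes laws of increments; the increment from 0 has the law of N(y) because
    N(0) = 0 almost surely. *)
Lemma poisson_process_marginal {d : measure_display} {T : measurableType d}
    {R : realType} (P : probability T R) (lambda : R) (N : R -> T -> nat) (y : R) (n : nat) :
  0 < lambda -> poisson_process P lambda N -> 0 < y ->
  P [set w | N y w = n] = (poisson_weight lambda n y)%:E.
Proof.
move=> l0 hN y0; have [[mN N0 _ _ _ _] pN] := hN.
transitivity (P [set w | (N y w)%:R - (N 0 w)%:R = n%:R :> R]).
  apply: ae_eq_probability.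
  - by apply: poisson_process_measurable hN _; exact: ltW.
  - rewrite (_ : [set w | _] = setT `&`
        ((fun w => (N y w)%:R : R) \- (fun w => (N 0 w)%:R)) @^-1` [set n%:R]).
      by apply: measurable_funB => //; apply: mN => //; exact: ltW.
    by rewrite setTI.
  apply: filterS N0 => w /= ->; rewrite subr0; split=> [->//|/eqP].
  by rewrite eqr_nat => /eqP.
rewrite pN// subr0 /poisson_pmf mulr_gt0// /poisson_weight gtr0_norm//.
Qed.

(** The witness is the expected Poisson weight at the inverse subordinator, a real function of time
    that carries the regularity; it is identified with the state probability separately at each t >
    0. *)
Lemma laplace_mfpp_state_probability (d : measure_display) (T : measurableType d) (R : realType)
    (P : probability T R)
    (alpha1 alpha2 lambda C1 C2 : R)
    (D : R -> T -> R) (N : R -> T -> nat)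
    (hlambda : 0 < lambda)
    (hC1 : 0 < C1) (hC2 : 0 <= C2)
    (hD : mixed_stable_subordinator P alpha1 alpha2 C1 C2 D)
    (hN : poisson_process P lambda N)
    (hND : independent_processes P N (inverse_subordinator D))
    (n : nat) :
  exists p : R -> R, [/\ forall t, 0 < t ->
      state_probability P (mixed_fractional_poisson N D) n t = (p t)%:E,
    forall t, 0 < t -> p x @[x --> t^'+] --> p t &
    forall s, 0 < s -> laplace_integrable p s /\
      laplace p s = lambda ^+ n * (C1 * s `^ (alpha1 - 1) + C2 * s `^ (alpha2 - 1)) /
        (lambda + C1 * s `^ alpha1 + C2 * s `^ alpha2) ^+ n.+1].
Proof.
have [[[mD D0 _ _ rcD _] _] laplD] := hD.
have D_le := subordinator_le hD.1.
pose phi s : R := C1 * s `^ alpha1 + C2 * s `^ alpha2.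
have phi_gt0 s : 0 < s -> 0 < phi s.
  by move=> s0; rewrite ltr_wpDr ?mulr_ge0 ?powR_ge0// mulr_gt0 ?powR_gt0.
have laplaceD s u : 0 <= s -> 0 <= u ->
    (\int[P]_w (expR (- (s * D u w)))%:E = (expR (- (u * phi s)))%:E)%E.
  by move=> s0 u0; have := laplD s u s0 u0; rewrite expectation.unlock.
pose p u := \int[P]_w poisson_weight lambda n (inverse_subordinator D u w).
exists p; split=> [t ht|t t0|s sp].
- rewrite /state_probability /mixed_fractional_poisson.
  have mY := measurable_inverse_subordinator1 t mD D_le.
    rewrite (@time_change_distribution _ _ _ P N (inverse_subordinator D t) n
      (poisson_weight lambda n)).
    - rewrite /p /Rintegral fineK//.
      exact: (integrable_fin_num _ (integrable_poisson_weight P n hlambda mD D_le t)).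
    - by move=> s s0; exact: poisson_process_measurable hN s0.
    - by move=> w s s0; have [[_ _ _ _ rcN _] _] := hN; exact: rcN.
    - exact: mY.
    - by move=> w; apply: inverse_subordinator_ge0.
    - by move=> y; exact: poisson_weight_ge0.
    - by move=> y; exact: poisson_weight_le1.
    - by move=> y; exact: continuous_poisson_weight.
    - by move=> y y0; exact: poisson_process_marginal hN y0.
    (* Independence is given for the sigma-algebras of the two processes; both events are among
       their generators, at times y and t. *)
    - move=> y B y0 mB; apply: hND; apply: sub_sigma_algebra.
        exists y; first exact: ltW.
        by exists [set n] => //; rewrite setTI.
      exists t; first exact: ltW.
      by exists B => //; rewrite setTI.
- exact: right_continuous_poisson_weight.
split; first exact: laplace_integrable_poisson_weight.
rewrite (laplace_poisson_weight n hlambda mD D_le rcD D0 phi_gt0 laplaceD sp).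
have sV x : s `^ (x - 1) = s `^ x / s.
  by rewrite powRD ?(gt_eqF sp) ?implybT// powR_inv1// ltW.
have := phi_gt0 s sp; rewrite !sV /phi -addrA => f0.
field.
by rewrite expf_neq0 ?(gt_eqF sp)// gt_eqF// addr_gt0.
Qed.

Theorem proposition3p1
    (d : measure_display) (T : measurableType d) (R : realType)
    (P : probability T R)
    (alpha1 alpha2 lambda C1 C2 : R)
    (D : R -> T -> R) (N : R -> T -> nat)
    (halpha2 : 0 < alpha2) (halpha : alpha2 < alpha1) (halpha1 : alpha1 < 1)
    (hlambda : 0 < lambda)
    (hC1 : 0 < C1) (hC2 : 0 <= C2) (hC : C1 + C2 = 1)
    (hD : mixed_stable_subordinator P alpha1 alpha2 C1 C2 D)
    (hN : poisson_process P lambda N)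
    (hND : independent_processes P N (inverse_subordinator D))
    (n : nat) (t : R) (ht : 0 < t) :
  state_probability P (mixed_fractional_poisson N D) n t =
  (lambda ^+ n / C1 ^+ n.+1 *
   (C1 * convolution_power (mfpp_f alpha1 alpha2 lambda C1 C2 n) n.+1 t +
    C2 * convolution_power (mfpp_g alpha1 alpha2 lambda C1 C2 n) n.+1 t))%:E.
Proof.
have [p [pE rcp lp]] := laplace_mfpp_state_probability hlambda hC1 hC2 hD hN hND n.
have [s0 s00 [crhs lrhs]] := laplace_mfpp_rhs n halpha2 halpha hlambda hC1 hC2.
rewrite (pE t ht); apply: (f_equal EFin).
(* The left transform is known for all s > 0 and the right one for s > s0, so the comparison takes
   place on s > s0. *)
apply: (laplace_unique rcp (fun u u0 => cvg_at_right_filter (crhs u u0)) _ ht) => s ss.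
have [ip ->] := lp s (lt_trans s00 ss); have [irhs ->] := lrhs s ss.
by split.
Qed.
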